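(* Let $a<b$, $\alpha\in(\frac12,1)$, $\sigma>0$, and let $L:\mathbb{R}\times\mathbb{R}\times[a,b]\to\mathbb{R}$, $(x,y,t)\mapsto L(x,y,t)$, be of class $C^1$. Assume: (1) there are $d_1\in(0,2]$ and $r_1,s_1\in C(\mathbb{R}\times[a,b],\mathbb{R}^+)$ such that $|L(x,y,t)-L(x,0,t)|\le r_1(x,t)|y|^{d_1}+s_1(x,t)$ for all $(x,y,t)\in\mathbb{R}\times\mathbb{R}\times[a,b]$; (2) there are $d_2\in(0,2]$ and $r_2,s_2\in C(\mathbb{R}\times[a,b],\mathbb{R}^+)$ such that $\left|\frac{\partial L}{\partial x}(x,y,t)\right|\le r_2(x,t)|y|^{d_2}+s_2(x,t)$ for all $(x,y,t)$; (3) there are $d_3\in(0,1]$ and $r_3,s_3\in C(\mathbb{R}\times[a,b],\mathbb{R}^+)$ such that $\left|\frac{\partial L}{\partial y}(x,y,t)\right|\le r_3(x,t)|y|^{d_3}+s_3(x,t)$ for all $(x,y,t)$; (4) there are $\zeta>0$, $d_4\in[1,2)$, $c_1\in C(\mathbb{R}\times[a,b],[\zeta,\infty))$ and $c_2,c_3\in C([a,b],\mathbb{R})$ such that $L(x,y,t)\ge c_1(x,t)|y|^2+c_2(t)|x|^{d_4}+c_3(t)$ for all $(x,y,t)$; (5) for every $t\in[a,b]$ the function $(x,y)\mapsto L(x,y,t)$ is convex. Then there exists $u_0\in\mathbb{H}_0^{\alpha,\sigma}(a,b)$ with $\mathcal{J}(u_0)=\min\{\mathcal{J}(u): u\in\mathbb{H}_0^{\alpha,\sigma}(a,b)\}$.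 If in addition $(x,y)\mapsto L(x,y,t)$ is strictly convex for every $t\in[a,b]$, then this minimizer is unique.
   Context: $\mathbb{R}^+=[0,\infty)$. The left Caputo tempered fractional derivative is ${}^{C}\mathbb{D}_{a^+}^{\alpha,\sigma}u(x)=\frac{e^{-\sigma x}}{\Gamma(1-\alpha)}\int_a^x (x-s)^{-\alpha}\,[e^{\sigma s}u(s)]'\,ds$, $x>a$. The space $\mathbb{H}_0^{\alpha,\sigma}(a,b)$ is the closure (completion) of $C_0^\infty(a,b)$ with respect to $\|u\|_{\alpha,\sigma}=\left(\int_a^b|u|^2dx+\int_a^b|{}^{C}\mathbb{D}_{a^+}^{\alpha,\sigma}u|^2dx\right)^{1/2}$. It is a Hilbert space of (for $\alpha>\frac12$, continuous) functions on $[a,b]$. For $u$ in this space, ${}^{C}\mathbb{D}_{a^+}^{\alpha,\sigma}u\in L^2(a,b)$ denotes the $L^2$-limit of ${}^{C}\mathbb{D}_{a^+}^{\alpha,\sigma}\varphi_n$ for any $\varphi_n\in C_0^\infty(a,b)$ converging to $u$ in the norm. The functional is $\mathcal{J}(u)=\int_a^b L\big(u(t),{}^{C}\mathbb{D}_{a^+}^{\alpha,\sigma}u(t),t\big)\,dt$ for $u\in\mathbb{H}_0^{\alpha,\sigma}(a,b)$. *)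

(* Defs.v *)
From HB Require Import structures.
From mathcomp Require Import all_boot all_order all_algebra.
From mathcomp Require Import all_classical all_reals all_analysis.

Set Implicit Arguments.
Unset Strict Implicit.
Unset Printing Implicit Defensive.

Import Order.TTheory GRing.Theory Num.Theory.
Import numFieldNormedType.Exports.

Local Open Scope classical_set_scope.
Local Open Scope ring_scope.

Section CaputoTempered.
Context {R : realType}.
Local Notation mu := (@lebesgue_measure R).

Definition Gamma (z : R) : R :=
  \int[mu]_(t in `]0, +oo[) (t `^ (z - 1) * expR (- t)).

(* Real-valued smooth functions on R whose support is a compact subset of the
   open interval: the usual identification of C_0^oo(a, b) with its extension
   by zero. *)
Definition test_function (a b : R) (phi : R -> R) : Prop :=
  [/\ forall (n : nat) (x : R), derivable (derive1n n phi) x 1,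
      compact (closure [set x | phi x != 0]) &
      closure [set x | phi x != 0] `<=` `]a, b[].

Definition caputo (a alpha sigma : R) (u : R -> R) (x : R) : R :=
  expR (- (sigma * x)) / Gamma (1 - alpha) *
  \int[mu]_(s in `[a, x])
     ((x - s) `^ (- alpha) * derive1 (fun r : R => expR (sigma * r) * u r) s).

Definition tempered_norm (a b alpha sigma : R) (u : R -> R) : \bar R :=
  ((\int[mu]_(x in `[a, b]) (`|u x| ^+ 2)%:E +
    \int[mu]_(x in `[a, b]) (`|caputo a alpha sigma u x| ^+ 2)%:E)
   `^ 2^-1)%E.

(* L^2(a, b), through extension by zero to the whole line. *)
Definition L2 (a b : R) (v : R -> R) : Prop :=
  v \_ `[a, b] \in Lfun mu 2%:E.

Definition L2_norm (a b : R) (f : R -> R) : \bar R :=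
  Lnorm mu 2%:E (EFin \o (f \_ `[a, b])).

Definition L2_cvg (a b : R) (f : nat -> R -> R) (v : R -> R) : Prop :=
  L2_norm a b (f n \- v) @[n --> \oo] --> 0%E.

(* A sequence of test functions representing the element u of the completion:
   it is Cauchy for the tempered norm and its L^2 limit is u. *)
Definition approximates (a b alpha sigma : R) (phi : nat -> R -> R)
    (u : R -> R) : Prop :=
  [/\ forall n, test_function a b (phi n),
      forall e : R, 0 < e -> exists N : nat, forall m n : nat,
        (N <= m)%N -> (N <= n)%N ->
        (tempered_norm a b alpha sigma (phi m \- phi n)%R < e%:E)%E &
      L2_cvg a b phi u].

(* Elements are represented by their continuous representative on [a, b], which
   exists for 1/2 < alpha; the values outside [a, b] are irrelevant. *)
Definition Hspace (a b alpha sigma : R) : set (R -> R) :=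
  [set u | {within `[a, b], continuous u} /\
           exists phi, approximates a b alpha sigma phi u].

(* The common L^2 limit of the derivatives along all approximating sequences
   (unique only up to a.e. equality, hence the choice of a representative). *)
Definition caputoH (a b alpha sigma : R) (u : R -> R) : R -> R :=
  xget (fun=> 0)
    [set v | L2 a b v /\
       forall phi, approximates a b alpha sigma phi u ->
         L2_cvg a b (fun n => caputo a alpha sigma (phi n)) v].

Definition action (a b alpha sigma : R) (L : R -> R -> R -> R)
    (u : R -> R) : R :=
  \int[mu]_(t in `[a, b]) L (u t) (caputoH a b alpha sigma u t) t.

Definition minimizer (a b alpha sigma : R) (L : R -> R -> R -> R)
    (u0 : R -> R) : Prop :=
  Hspace a b alpha sigma u0 /\
  forall u, Hspace a b alpha sigma u ->
    action a b alpha sigma L u0 <= action a b alpha sigma L u.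

Definition continuous_strip2 (a b : R) (f : R -> R -> R) : Prop :=
  {within [set p : R * R | p.2 \in `[a, b]],
    continuous (fun p : R * R => f p.1 p.2)}.

Definition continuous_strip3 (a b : R) (f : R -> R -> R -> R) : Prop :=
  {within [set p : R * R * R | p.2 \in `[a, b]],
    continuous (fun p : R * R * R => f p.1.1 p.1.2 p.2)}.

Definition partial_x (L : R -> R -> R -> R) (x y t : R) : R :=
  derive1 (fun z : R => L z y t) x.

Definition partial_y (L : R -> R -> R -> R) (x y t : R) : R :=
  derive1 (fun z : R => L x z t) y.

(* Class C^1 on R x R x [a, b]; the derivative in t is relative to [a, b], so
   one-sided at the endpoints. *)
Definition C1_strip (a b : R) (L : R -> R -> R -> R) : Prop :=
  [/\ continuous_strip3 a b L,
      forall x y t, t \in `[a, b] ->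
        derivable (fun z : R => L z y t) x 1 /\
        derivable (fun z : R => L x z t) y 1,
      continuous_strip3 a b (partial_x L),
      continuous_strip3 a b (partial_y L) &
      exists2 Lt : R -> R -> R -> R, continuous_strip3 a b Lt &
        forall x y t, t \in `[a, b] ->
          (L x y s - L x y t) / (s - t) @[s --> within `[a, b] t^'] -->
            Lt x y t].

Definition strictly_convex_function (E : lmodType R) (f : E -> R) : Prop :=
  forall (k : R) (p q : E), 0 < k -> k < 1 -> p <> q ->
    f (k *: p + (1 - k) *: q) < k * f p + (1 - k) * f q.

End CaputoTempered.

(* Main.v *)
(* Proof by the direct method, with strong instead of weak compactness.

   For a test function [phi] the Riemann-Liouville integral of order [alpha]
   inverts the Caputo derivative (Abel's identity), so by Cauchy-Schwarz, since
   [alpha > 1/2], the sup norm of [phi] is controlled by the L^2 norm of its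
   Caputo derivative.  Abel's identity applied once more, with order
   [1 - alpha], shows that the derivative is closable in L^2.  Hence the space
   is the set of first components of the closure of
   [{(phi, caputo phi)}], and [caputoH u] is the second component.

   By (4) the sublevel sets of the functional are bounded in L^2 of the
   derivative, and by (5) they are convex.  Choosing in the [n]-th sublevel set
   an element of almost minimal L^2 norm of the derivative gives, by the
   parallelogram identity, a Cauchy sequence.  Its limit is a minimizer by
   Fatou's lemma along an almost everywhere convergent subsequence.  Under
   strict convexity two minimizers are compared with their midpoint. *)

Require Import Defs.
From HB Require Import structures.
From mathcomp Require Import all_boot all_order all_algebra.
From mathcomp Require Import all_classical all_reals all_analysis.
From mathcomp Require Import measurable_realfun ring lra.

Set Implicit Arguments.
Unset Strict Implicit.
Unset Printing Implicit Defensive.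

Import Order.TTheory GRing.Theory Num.Theory.
Import numFieldNormedType.Exports.

Local Open Scope classical_set_scope.
Local Open Scope ring_scope.

(** * Affine change of variables *)

Section affine.
Context {R : realType}.
Local Notation mu := (@lebesgue_measure R).

(** Weakly convergent derivatives would give no pointwise limit of the nonlinear integrand, whereas
    Fatou's lemma needs almost everywhere convergence; selecting nearly norm-minimal elements
    supplies strong convergence directly. The sup bound turns L^2 convergence of derivatives into
    uniform convergence of the functions, so [u] is a genuine continuous function, while its
    derivative [v] is determined only almost everywhere. The argument therefore runs on pairs
    [(u, v)] in [graph] and returns to [caputoH], which is a choice of representative, only for the
    final statements. Abel's identity is proved with kernels truncated at length [b - a]: being
    integrable on the line, they allow Fubini for convolutions with functions extended by zero. The
    exponential factors disappear by working with [expR (sigma * r) * phi r]. The bound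
    [alpha > 1/2] says that the squared kernel, of order [2 * alpha - 1], is integrable. The bound
    [d4 < 2] lets the term in [x] of the lower bound on [L] be absorbed by the quadratic term in the
    derivative. *)

Lemma ae_imply (P Q : R -> Prop) : (forall x, P x -> Q x) ->
  {ae mu, forall x, P x} -> {ae mu, forall x, Q x}.
Proof.
by move=> PQ; apply: filterS => //; exact: (ae_filter_ringOfSetsType mu).
Qed.

(** The image of Lebesgue measure under the map, rescaled by [c], agrees with Lebesgue measure on
    half-open intervals, hence everywhere by uniqueness. Going through measures makes the change of
    variables valid for singular integrands. *)
Lemma lebesgue_measure_affine (c d : R) (A : set R) : 0 < c ->
  measurable A ->
  mu ((fun x => c * x + d) @^-1` A) = (c^-1%:E * mu A)%E.
Proof.
move=> c0 mA.
have mphi : @measurable_fun _ _ (measurableTypeR R) (measurableTypeR R) setT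
    (fun x => c * x + d).
  by apply: measurable_funD => //; exact: measurable_funM.
have ci0 : (0 <= c)%R by exact: ltW.
pose phi (x : measurableTypeR R) : measurableTypeR R := c * x + d.
have nuE X : measurable X -> mu X = mscale (NngNum ci0) (pushforward mu phi) X.
  apply: lebesgue_measure_unique => //= _ [[x y]] _ <-.
  rewrite /mscale /= /pushforward.
  have -> : phi @^-1` `]x, y] = `]((x - d) / c), ((y - d) / c)]%classic.
    apply/seteqP; split => z; rewrite /phi /= !in_itv/= => /andP[h1 h2].
      by rewrite ltr_pdivrMr// ler_pdivlMr//; apply/andP; split; lra.
    move: h1 h2; rewrite ltr_pdivrMr// ler_pdivlMr// => h1 h2.
    by apply/andP; split; lra.
  rewrite !lebesgue_measure_itv/= !lte_fin ltr_pM2r ?invr_gt0// ltrD2r.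
  case: ifPn => xy; last by rewrite mule0.
  rewrite -!EFinD -EFinM; congr EFin.
  by field; rewrite gt_eqF.
rewrite (nuE mphi A mA) /mscale /= /pushforward muleA -EFinM mulVf ?gt_eqF//.
by rewrite mul1e.
Qed.

Lemma ge0_integral_affine (c d : R) (f : R -> \bar R) : 0 < c ->
  measurable_fun setT f -> (forall x, 0 <= f x)%E ->
  (\int[mu]_x f (c * x + d)%R = c^-1%:E * \int[mu]_x f x)%E.
Proof.
move=> c0 mf f0.
have mphi : @measurable_fun _ _ (measurableTypeR R) (measurableTypeR R) setT
    (fun x => c * x + d).
  by apply: measurable_funD => //; exact: measurable_funM.
have ci0 : (0 <= c^-1)%R by rewrite invr_ge0 ltW.
pose phi (x : measurableTypeR R) : measurableTypeR R := c * x + d.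
have -> : (c^-1%:E * \int[mu]_x f x)%E =
   (\int[mscale (NngNum ci0) mu]_x f x)%E.
  by rewrite ge0_integral_mscale.
transitivity (\int[pushforward mu phi]_x f x)%E.
  by rewrite (ge0_integral_pushforward mphi).
apply: eq_measure_integral => //= A mA _.
by rewrite /pushforward lebesgue_measure_affine.
Qed.

Lemma ge0_integral_oppr (f : R -> \bar R) :
  measurable_fun setT f -> (forall x, 0 <= f x)%E ->
  (\int[mu]_x f (- x)%R = \int[mu]_x f x)%E.
Proof.
move=> mf f0.
pose phi : measurableTypeR R -> measurableTypeR R := -%R.
have mphi : measurable_fun setT phi by exact: measurable_funN.
transitivity (\int[pushforward mu phi]_x f x)%E.
  by rewrite (ge0_integral_pushforward mphi).
by apply: eq_measure_integral => //= A mA _; exact: lebesgue_measureN.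
Qed.

Lemma ge0_integral_shift_sub (x : R) (f : R -> \bar R) :
  measurable_fun setT f -> (forall z, 0 <= f z)%E ->
  (\int[mu]_s f (x - s)%R = \int[mu]_z f z)%E.
Proof.
move=> mf f0.
rewrite -(ge0_integral_oppr mf f0).
have := @ge0_integral_affine 1 (- x) (fun z => f (- z)%R) ltr01.
rewrite invr1 mul1e => <- //.
- by apply: eq_integral => s _; congr f; ring.
- exact: measurableT_comp.
Qed.

End affine.

(** * Abel kernels *)

Section kernel.
Context {R : realType}.
Local Notation mu := (@lebesgue_measure R).

(* The truncation at [T] makes the kernel integrable on the line; it is invisible
   in convolutions with functions supported in an interval of length [T]. *)
Definition kern (p T z : R) : R :=
  if (0 < z) && (z <= T) then z `^ (p - 1) else 0.

Lemma kern_ge0 p T z : 0 <= kern p T z.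
Proof. by rewrite /kern; case: ifP => // _; exact: powR_ge0. Qed.

Lemma measurable_kern p T : measurable_fun setT (kern p T).
Proof.
apply: measurable_fun_ifT => //.
by apply: measurable_and; [apply: measurable_fun_ltr|apply: measurable_fun_ler].
Qed.

Lemma integral_powR_cc (p e T : R) : 0 < p -> 0 < e -> e < T ->
  (\int[mu]_(z in `[e, T]) (z `^ (p - 1))%:E <= (T `^ p / p)%:E)%E.
Proof.
move=> p0 e0 eT.
have dP (x : R) : 0 < x -> derivable (fun z : R => z `^ p / p) x 1.
  by move=> x0; apply: derivableM => //; apply: derivable_powR; rewrite in_itv/= x0.
have cP (q x : R) : 0 < x -> {for x, continuous (fun z : R => z `^ q)}.
  move=> x0; apply: differentiable_continuous; apply/derivable1_diffP.
  by apply: derivable_powR; rewrite in_itv/= x0.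
have cF (x : R) : 0 < x -> {for x, continuous (fun z : R => z `^ p / p)}.
  move=> x0; apply: differentiable_continuous; apply/derivable1_diffP.
  exact: dP.
rewrite (@continuous_FTC2 _ _ (fun z => z `^ p / p)) //.
- rewrite -EFinB lee_fin lerBlDr lerDl divr_ge0 ?powR_ge0// ltW//.
- apply: continuous_in_subspaceT => x; rewrite inE/= in_itv/= => /andP[ex _].
  by apply: cP; exact: lt_le_trans ex.
- split.
  + move=> x; rewrite in_itv/= => /andP[ex _]; apply: dP; exact: lt_trans ex.
  + exact: cvg_at_right_filter (cF _ _).
  + by apply: cvg_at_left_filter; apply: cF; exact: lt_trans eT.
- move=> x; rewrite in_itv/= => /andP[ex _].
  have x0 : 0 < x by exact: lt_trans ex.
  rewrite derive1Mr; last by apply: derivable_powR; rewrite in_itv/= x0.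
  by rewrite powR_derive1 ?in_itv/= ?x0// mulrAC divff ?mul1r ?gt_eqF.
Qed.

(** The singularity at 0 is approached by monotone convergence along the segments from [1 / (i + 1)]
    to [T], on which [integral_powR_cc] gives a bound independent of the left endpoint. *)
Lemma integral_kern_lty p T : 0 < p -> (\int[mu]_z (kern p T z)%:E < +oo)%E.
Proof.
move=> p0.
have [T0|T0] := leP T 0.
  rewrite integral0_eq// => z _; rewrite /kern; case: ifP => // /andP[z0 zT].
  by have := lt_le_trans z0 (le_trans zT T0); rewrite ltxx.
pose F (i : nat) : set R := `[i.+1%:R^-1, T]%classic.
have mF i : measurable (F i) by exact: measurable_itv.
have cF : \bigcup_i F i = `]0, T]%classic.
  apply/seteqP; split => z /=.
    move=> [i _]; rewrite /F /= !in_itv/= => /andP[iz ->]; rewrite andbT.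
    by apply: lt_le_trans iz; rewrite invr_gt0 ltr0n.
  rewrite in_itv/= => /andP[z0 zT].
  have [i iz] := ltr_add_invr z0.
  exists i => //; rewrite /F/= in_itv/= zT andbT ltW//.
  by rewrite add0r in iz.
have -> : (\int[mu]_z (kern p T z)%:E = \int[mu]_(z in `]0%R, T]) (z `^ (p - 1))%:E)%E.
  rewrite [RHS]integral_mkcond; apply: eq_integral => z _.
  rewrite patchE /kern mem_setE in_itv/=; by case: ifP.
rewrite -cF.
apply: (@le_lt_trans _ _ (T `^ p / p)%:E); last by rewrite ltry.
have ndF : {homo F : n m / (n <= m)%N >-> (n <= m)%O}.
  move=> i j ij; apply/subsetPset; apply: subset_itvr; rewrite bnd_simp.
  by rewrite lef_pV2 ?posrE ?ltr0n// ler_nat.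
have mf i : measurable_fun (F i) (fun z : R => (z `^ (p - 1))%:E).
  by apply/measurable_EFinP; apply: measurable_funTS; exact: measurable_powR.
have f0 (i : nat) z : F i z -> (0 <= (z `^ (p - 1))%:E)%E.
  by move=> _; rewrite lee_fin powR_ge0.
have H := ge0_nondecreasing_set_cvg_integral (mu := mu) ndF mF mf f0.
apply: (cvge_le _ H).
apply: nearW => i.
have i0 : 0 < i.+1%:R^-1 :> R by rewrite invr_gt0 ltr0n.
have [iT|Ti] := ltP i.+1%:R^-1 T; first exact: integral_powR_cc.
have [iT|nT] := eqVneq (i.+1%:R^-1) T.
  by rewrite /F iT set_itv1 integral_set1 lee_fin divr_ge0 ?powR_ge0// ltW.
rewrite /F set_itv_ge ?integral_set0 ?lee_fin ?divr_ge0 ?powR_ge0// ?ltW//.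
by rewrite bnd_simp -ltNge lt_neqAle Ti andbT eq_sym nT.
Qed.

Lemma integrable_kern p T : 0 < p -> mu.-integrable setT (EFin \o kern p T).
Proof.
move=> p0; apply/integrableP; split.
  by apply/measurable_EFinP; exact: measurable_kern.
under eq_integral do rewrite gee0_abs ?lee_fin ?kern_ge0//.
exact: integral_kern_lty.
Qed.

End kernel.

(** * Convolution with truncated kernels *)

Section kernel_convolution.
Context {R : realType}.
Local Notation mu := (@lebesgue_measure R).
Implicit Types (p T x y : R) (h : R -> R).

Definition kern_mass p T : R := \int[mu]_z kern p T z.

Lemma EFin_kern_mass p T : 0 < p ->
  ((kern_mass p T)%:E = \int[mu]_z (kern p T z)%:E)%E.
Proof.
by move=> p0; rewrite fineK// integrable_fin_num//; exact: integrable_kern.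
Qed.

Lemma kern_mass_ge0 p T : 0 <= kern_mass p T.
Proof. by apply: Rintegral_ge0 => z _; exact: kern_ge0. Qed.

Lemma integral_kern_shift p T x :
  (\int[mu]_s (kern p T (x - s))%:E = \int[mu]_z (kern p T z)%:E)%E.
Proof.
rewrite (@ge0_integral_shift_sub _ x (EFin \o kern p T))//.
- by apply/measurable_EFinP; exact: measurable_kern.
- by move=> z; rewrite lee_fin kern_ge0.
Qed.

Lemma measurable_kern_shift p T x :
  measurable_fun setT (fun s : R => kern p T (x - s)).
Proof.
by apply: measurableT_comp; [exact: measurable_kern|exact: measurable_funB].
Qed.

Lemma integrable_kern_shift p T x : 0 < p ->
  mu.-integrable setT (fun s : R => (kern p T (x - s))%:E).
Proof.
move=> p0; apply/integrableP; split.
  by apply/measurable_EFinP; exact: measurable_kern_shift.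
under eq_integral do rewrite gee0_abs ?lee_fin ?kern_ge0//.
by rewrite integral_kern_shift integral_kern_lty.
Qed.

Lemma integrable_kernM p T h (B : R) x : 0 < p ->
  measurable_fun setT h -> (forall s, `|h s| <= B) ->
  mu.-integrable setT (fun s : R => (kern p T (x - s) * h s)%:E).
Proof.
move=> p0 mh hB.
apply: (@le_integrable _ _ R mu setT measurableT _ (fun s : R => (B%:E * (kern p T (x - s))%:E)%E)) => //.
- apply/measurable_EFinP; apply: measurable_funM => //.
  exact: measurable_kern_shift.
- move=> s _; rewrite -EFinM !abse_EFin lee_fin !normrM mulrC ler_wpM2r//.
  by rewrite (le_trans (hB s))// ler_norm.
- by apply: integrableZl => //; exact: integrable_kern_shift.
Qed.

Definition kern_conv p T h x : R := \int[mu]_s (kern p T (x - s) * h s).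

Lemma EFin_kern_conv p T h (B : R) x : 0 < p ->
  measurable_fun setT h -> (forall s, `|h s| <= B) ->
  ((kern_conv p T h x)%:E = \int[mu]_s (kern p T (x - s) * h s)%:E)%E.
Proof.
move=> p0 mh hB.
by rewrite fineK// integrable_fin_num//; apply: integrable_kernM p0 mh hB.
Qed.

Lemma kern_conv_bounded p T h (B : R) x : 0 < p ->
  measurable_fun setT h -> (forall s, `|h s| <= B) ->
  `|kern_conv p T h x| <= B * kern_mass p T.
Proof.
move=> p0 mh hB.
have B0 : 0 <= B by exact: le_trans (hB 0).
apply: (le_trans (le_normr_Rintegral _ _)) => //.
  exact: integrable_kernM p0 mh hB.
rewrite -lee_fin EFinM EFin_kern_mass// -(integral_kern_shift _ _ x).
rewrite -ge0_integralZl_EFin//; last 2 first.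
- by move=> s _; rewrite lee_fin kern_ge0.
- by apply/measurable_EFinP; exact: measurable_kern_shift.
rewrite fineK; last first.
  apply: integrable_fin_num => //.
  have := @integrable_kernM p T h B x p0 mh hB => /integrable_norm.
  by apply: eq_integrable.
apply: ge0_le_integral => //.
- by apply/measurable_EFinP; apply: measurableT_comp => //;
    apply: measurable_funM => //; exact: measurable_kern_shift.
- apply/measurable_EFinP; apply: measurable_funM => //.
  exact: measurable_kern_shift.
- move=> s _; rewrite -EFinM lee_fin normrM (ger0_norm (kern_ge0 _ _ _)).
  by rewrite [leRHS]mulrC ler_wpM2l ?kern_ge0.
Qed.

Lemma measurable_kern_prod p T h : measurable_fun setT h ->
  measurable_fun setT (fun z : R * R => kern p T (z.1 - z.2) * h z.2).
Proof.
move=> mh; apply: measurable_funM.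
  by apply: measurableT_comp; [exact: measurable_kern|exact: measurable_funB].
exact: measurableT_comp.
Qed.

(** By Tonelli with [x] integrated first: translation invariance makes the inner integral
    [kern_mass p T] times the absolute value of [h s]. Fubini then yields the measurability of
    [kern_conv] in its last argument. *)
Lemma integrable_kern_prod p T h : 0 < p -> mu.-integrable setT (EFin \o h) ->
  (mu \x mu)%E.-integrable setT
    (fun z : R * R => (kern p T (z.1 - z.2) * h z.2)%:E).
Proof.
move=> p0 ih.
have mh : measurable_fun setT h.
  by have /integrableP[/measurable_EFinP] := ih.
apply/integrable21ltyP.
  by apply/measurable_EFinP; exact: measurable_kern_prod.
have -> : (\int[mu]_s \int[mu]_x `|(kern p T (x - s) * h s)%:E| =
  \int[mu]_s ((kern_mass p T)%:E * `|(h s)%:E|))%E.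
  apply: eq_integral => s _.
  rewrite muleC EFin_kern_mass//.
  have := @ge0_integral_affine _ 1 (- s) (EFin \o kern p T) ltr01.
  rewrite invr1 mul1e => /= <-; last 2 first.
  - by apply/measurable_EFinP; exact: measurable_kern.
  - by move=> z; rewrite lee_fin kern_ge0.
  rewrite -ge0_integralZl//; last 2 first.
  - apply/measurable_EFinP; apply: measurableT_comp; first exact: measurable_kern.
    by apply: measurable_funD => //; exact: measurable_funM.
  - by move=> z _; rewrite lee_fin kern_ge0.
  apply: eq_integral => z _.
  by rewrite mul1r normrM (ger0_norm (kern_ge0 _ _ _)) mulrC EFinM.
rewrite ge0_integralZl//; last 2 first.
- by apply: measurableT_comp => //; exact/measurable_EFinP.
- by rewrite lee_fin kern_mass_ge0.
have /integrableP[_ hlt] := ih.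
by rewrite lte_mul_pinfty ?lee_fin ?kern_mass_ge0.
Qed.

Lemma measurable_kern_conv p T h : 0 < p -> mu.-integrable setT (EFin \o h) ->
  measurable_fun setT (kern_conv p T h).
Proof.
move=> p0 ih; apply: (@measurableT_comp _ _ _ _ _ _ (@fine R)) => //.
exact: measurable_fubini_F (integrable_kern_prod T p0 ih).
Qed.

End kernel_convolution.

(** * The Beta integral and Abel's inversion *)

Section abel.
Context {R : realType}.
Local Notation mu := (@lebesgue_measure R).
Implicit Types (p T x y : R) (h : R -> R).

(* The Beta integral [B(1 - p, p)]; only its finiteness and positivity matter. *)
Definition beta_mass p : \bar R :=
  (\int[mu]_r (kern (1 - p) 1 (1 - r) * kern p 1 r)%:E)%E.

Let measurable_beta p : measurable_fun setT
  (fun r : R => kern (1 - p) 1 (1 - r) * kern p 1 r).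
Proof.
by apply: measurable_funM; [exact: measurable_kern_shift|exact: measurable_kern].
Qed.

Lemma beta_mass_lty p : 0 < p < 1 -> (beta_mass p < +oo)%E.
Proof.
move=> /andP[p0 p1]; have q0 : 0 < 1 - p by rewrite subr_gt0.
have half0 : (0 < 2^-1 :> R) by rewrite invr_gt0.
(* Each half of the unit interval contains one singularity only; on it the other factor is at most
   [(1/2)^(q - 1) = 2^(1 - q) <= 2]. *)
have le2 (q z : R) : 0 < q -> q < 1 -> 2^-1 <= z -> z `^ (q - 1) <= 2.
  move=> q00 q1 z2; have z0 : 0 < z by exact: lt_le_trans z2.
  have -> : q - 1 = - (1 - q) by ring.
  rewrite powRN invf_ple ?posrE ?powR_gt0//; apply: le_trans (_ : 2^-1 `^ (1 - q) <= _).
    by rewrite ger1_powR ?half0 ?invf_le1//; lra.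
  by apply: ge0_ler_powR; rewrite ?nnegrE//; lra.
apply: (@le_lt_trans _ _ (\int[mu]_r (2%:E * (kern p 1 r)%:E +
   2%:E * (kern (1 - p) 1 (1 - r))%:E))%E).
  apply: ge0_le_integral => //.
  - by move=> r _; rewrite lee_fin mulr_ge0 ?kern_ge0.
  - by apply/measurable_EFinP; exact: measurable_beta.
  - apply: emeasurable_funD; apply: emeasurable_funM => //; apply/measurable_EFinP.
      exact: measurable_kern.
    exact: measurable_kern_shift.
  - move=> r _; rewrite -!EFinM -EFinD lee_fin.
    have [rh|rh] := leP r 2^-1.
      apply: (@le_trans _ _ (2 * kern p 1 r)); last first.
        by rewrite lerDl mulr_ge0 ?kern_ge0.
      rewrite ler_wpM2r ?kern_ge0// /kern; case: ifP => // _.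
      by apply: le2 => //; lra.
    apply: (@le_trans _ _ (2 * kern (1 - p) 1 (1 - r))); last first.
      by rewrite lerDr mulr_ge0 ?kern_ge0.
    rewrite mulrC ler_wpM2r ?kern_ge0// /kern; case: ifP => // _.
    by apply: le2 => //; exact: ltW.
have m1 : measurable_fun setT (EFin \o @kern R p 1).
  by apply/measurable_EFinP; exact: measurable_kern.
have m2 : measurable_fun setT (fun r : R => (kern (1 - p) 1 (1 - r))%:E).
  by apply/measurable_EFinP; exact: measurable_kern_shift.
rewrite ge0_integralD//; last 4 first.
- by move=> r _; rewrite mule_ge0// lee_fin kern_ge0.
- exact: emeasurable_funM.
- by move=> r _; rewrite mule_ge0// lee_fin kern_ge0.
- exact: emeasurable_funM.
rewrite !ge0_integralZl//; last 2 first.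
- by move=> r _; rewrite lee_fin kern_ge0.
- by move=> r _; rewrite lee_fin kern_ge0.
rewrite integral_kern_shift lte_add_pinfty// lte_mul_pinfty//;
  exact: integral_kern_lty.
Qed.

Lemma kern_ge1 p z : p <= 1 -> 0 < z -> z <= 1 -> 1 <= kern p 1 z.
Proof.
move=> p1 z0 z1; rewrite /kern z0 z1/=.
have -> : p - 1 = - (1 - p) by ring.
rewrite powRN -[leLHS]invr1 lef_pV2 ?posrE ?powR_gt0//.
have e1 : (1 : R) `^ (1 - p) = 1 by rewrite powR1.
rewrite -[leRHS]e1; apply: ge0_ler_powR; rewrite ?nnegrE ?subr_ge0//.
exact: ltW.
Qed.

Let lebesgue_measure01 : mu `]0, 1[%classic = 1%E.
Proof. by rewrite lebesgue_measure_itv/= lte_fin ltr01 sube0. Qed.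

(** Both exponents are negative, so both factors are at least 1 on []0, 1[]. The resulting
    positivity allows division by the constant in Abel's identity. *)
Lemma beta_mass_ge1 p : 0 < p < 1 -> (1 <= beta_mass p)%E.
Proof.
move=> /andP[p0 p1].
have -> : 1%E = (\int[mu]_(r in `]0%R, 1%R[) cst 1 r)%E :> \bar R.
  by rewrite integral_cst// mul1e; apply/esym; exact: lebesgue_measure01.
rewrite integral_mkcond; apply: ge0_le_integral => //.
- by move=> r _; rewrite patchE; case: ifP.
- by apply: (measurable_restrictT _ _).1 => //.
- by apply/measurable_EFinP; exact: measurable_beta.
- move=> r _; rewrite patchE mem_setE in_itv/=; case: ifPn => [/andP[r0 r1]|_].
    rewrite lee_fin -[leLHS]mulr1 ler_pM// kern_ge1//; lra.
  by rewrite lee_fin mulr_ge0 ?kern_ge0.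
Qed.

(** Substituting [z = l * r + x] with [l = y - x], the powers of [l] are [l^(-p)] and [l^(p - 1)]
    from the kernels and [l] from the Jacobian; they cancel. Since [l <= T], neither truncation is
    active between [x] and [y]; for [y <= x] the kernels have disjoint supports. *)
Lemma integral_kern_kern p T x y : 0 < p < 1 -> y - x <= T ->
  (\int[mu]_z (kern (1 - p) T (y - z) * kern p T (z - x))%:E =
   if (x < y)%R then beta_mass p else 0)%E.
Proof.
move=> /andP[p0 p1] yxT; case: ifPn => [xy|]; last first.
  rewrite -leNgt => yx; apply: integral0_eq => z _.
  rewrite /kern; case: ifP => [/andP[yz _]|]; last by rewrite mul0r.
  case: ifP => [/andP[zx _]|]; last by rewrite mulr0.
  by exfalso; lra.
pose l := y - x.
have l0 : 0 < l by rewrite subr_gt0.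
pose f z := (kern (1 - p) T (y - z) * kern p T (z - x))%:E.
have mf : measurable_fun setT f.
  apply/measurable_EFinP; apply: measurable_funM.
    exact: measurable_kern_shift.
  by apply: measurableT_comp; [exact: measurable_kern|exact: measurable_funB].
have f0 z : (0 <= f z)%E by rewrite lee_fin mulr_ge0 ?kern_ge0.
have lM (A B : \bar R) : (A = l^-1%:E * B -> B = l%:E * A)%E.
  by move=> ->; rewrite muleA -EFinM divff ?gt_eqF// mul1e.
rewrite (lM _ _ (ge0_integral_affine x l0 mf f0)).
rewrite -ge0_integralZl//; last 2 first.
- apply: measurableT_comp => //.
  by apply: measurable_funD => //; exact: measurable_funM.
- exact: ltW.
rewrite /beta_mass; apply: eq_integral => r _.
rewrite /f -EFinM; congr EFin.
have -> : y - (l * r + x) = l * (1 - r) by rewrite /l; ring.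
have -> : l * r + x - x = l * r by ring.
rewrite /kern !pmulr_rgt0// !subr_gt0.
have [r0|r0] := ltP 0 r; last first.
  by rewrite /= !mulr0.
have [r1|r1] := ltP r 1; last first.
  by rewrite /= !mul0r mulr0.
have -> : l * (1 - r) <= T.
  by apply: le_trans yxT; rewrite -/l ler_piMr ?ltW//; lra.
have -> : l * r <= T.
  by apply: le_trans yxT; rewrite -/l ler_piMr ?ltW.
have -> : 1 - r <= 1 by lra.
rewrite (ltW r1) /= !powRM ?ltW// ?subr_gt0//.
have lE : l `^ 1 * l `^ (1 - p - 1) * l `^ (p - 1) = 1.
  rewrite -!powRD; [|by rewrite (gt_eqF l0) implybT..].
  by rewrite (_ : 1 + (1 - p - 1) + (p - 1) = 0) ?powRr0//; ring.
rewrite powRr1 ?ltW// in lE.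
have lN (A B u v : R) : l * A * B = 1 -> l * (A * u * (B * v)) = u * v.
  by move=> lAB; rewrite -[RHS]mul1r -lAB; ring.
exact: lN.
Qed.

(* Abel's inversion: by Fubini the two kernels combine into the Beta integral,
   which does not depend on the endpoints. *)
Lemma kern_conv_kern_conv p T h (B : R) y : 0 < p < 1 ->
  mu.-integrable setT (EFin \o h) -> (forall s, `|h s| <= B) ->
  (forall s, s < y - T -> h s = 0) ->
  kern_conv (1 - p) T (kern_conv p T h) y =
  fine (beta_mass p) * \int[mu]_(s in `]-oo, y[) h s.
Proof.
move=> p01 ih hB hy; have /andP[p0 p1] := p01.
have q0 : 0 < 1 - p by rewrite subr_gt0.
have mh : measurable_fun setT h.
  by have /integrableP[/measurable_EFinP] := ih.
have kapE : (fine (beta_mass p))%:E = beta_mass p.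
  rewrite fineK// ge0_fin_numE ?beta_mass_lty//.
  exact: le_trans (beta_mass_ge1 p01).
pose F (z : R * R) :=
  (kern (1 - p) T (y - z.1) * (kern p T (z.1 - z.2) * h z.2))%:E.
have mF : measurable_fun setT F.
  apply/measurable_EFinP; apply: measurable_funM.
    by apply: measurableT_comp; [exact: measurable_kern|exact: measurable_funB].
  exact: measurable_kern_prod.
have inner s (k : R) : (\int[mu]_x (`|k| * (kern (1 - p) T (y - x) * kern p T (x - s)))%:E
    = `|k|%:E * \int[mu]_x (kern (1 - p) T (y - x) * kern p T (x - s))%:E)%E.
  under eq_integral do rewrite EFinM.
  rewrite ge0_integralZl//.
  - apply/measurable_EFinP; apply: measurable_funM.
      exact: measurable_kern_shift.
    by apply: measurableT_comp; [exact: measurable_kern|exact: measurable_funB].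
  - by move=> x _; rewrite lee_fin mulr_ge0 ?kern_ge0.
(* Where [h] is nonzero, [hy] forces [y - s <= T], which is the condition under which the truncation
   is invisible. *)
have innerE s : h s != 0 ->
    (\int[mu]_x (kern (1 - p) T (y - x) * kern p T (x - s))%:E =
    if (s < y)%R then beta_mass p else 0)%E.
  move=> hs; apply: integral_kern_kern => //.
  by rewrite leNgt; apply/negP => ys; move: hs; rewrite hy ?eqxx//; lra.
have iF : (mu \x mu)%E.-integrable setT F.
  apply/integrable21ltyP => //.
  apply: (@le_lt_trans _ _ (\int[mu]_s (beta_mass p * `|(h s)%:E|))%E).
    apply: ge0_le_integral => //.
    - by move=> s _; exact: integral_ge0.
    - apply: (@measurable_fun_fubini_tonelli_G _ _ _ _ R mu (abse \o F)) => //=.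
      by apply: measurableT_comp.
    - by apply: emeasurable_funM => //; apply/measurable_EFinP; exact: measurableT_comp.
    - move=> s _.
      under eq_integral => x _.
        rewrite /F/= !normrM !(ger0_norm (kern_ge0 _ _ _)) mulrA mulrC.
        over.
      rewrite /= inner muleC.
      have [->|hs] := eqVneq (h s) 0; first by rewrite normr0 !mule0.
      rewrite innerE//; case: ifP => _ //.
      by rewrite mul0e mule_ge0// -kapE lee_fin fine_ge0// ltW// (lt_le_trans _ (beta_mass_ge1 p01)).
  have /integrableP[_ hlt] := ih.
  rewrite -kapE ge0_integralZl ?lee_fin ?fine_ge0//; last 2 first.
  - by apply: measurableT_comp => //; exact/measurable_EFinP.
  - by rewrite ltW// (lt_le_trans _ (beta_mass_ge1 p01)).
  by rewrite lte_mul_pinfty ?lee_fin ?fine_ge0// ltW// (lt_le_trans _ (beta_mass_ge1 p01)).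
have := Fubini iF.
have -> : (\int[mu]_x \int[mu]_s F (x, s) =
    \int[mu]_x (kern (1 - p) T (y - x) * kern_conv p T h x)%:E)%E.
  apply: eq_integral => x _.
  rewrite EFinM (EFin_kern_conv _ _ p0 mh hB) /F/=.
  under eq_integral do rewrite EFinM.
  by rewrite integralZl//; apply: integrable_kernM p0 mh hB.
move=> FE; rewrite /kern_conv /Rintegral FE.
have -> : (\int[mu]_s \int[mu]_x F (x, s) =
    \int[mu]_s ((fine (beta_mass p))%:E * ((EFin \o h) \_ `]-oo, y[) s))%E.
  apply: eq_integral => s _; rewrite patchE mem_setE in_itv/=.
  have [hs0|hs] := eqVneq (h s) 0.
    rewrite /F /= hs0 if_same mule0.
    by apply: integral0_eq => x _; rewrite !mulr0.
  rewrite kapE /F/=.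
  under eq_integral do rewrite mulrA mulrC EFinM.
  rewrite integralZl//; last first.
    apply/integrableP; split.
      apply/measurable_EFinP; apply: measurable_funM.
        exact: measurable_kern_shift.
      by apply: measurableT_comp; [exact: measurable_kern|exact: measurable_funB].
    under eq_integral do rewrite gee0_abs ?lee_fin ?mulr_ge0 ?kern_ge0//.
    by rewrite innerE//; case: ifP => // _; exact: beta_mass_lty.
  by rewrite innerE//; case: ifP => _; rewrite ?mule0// muleC.
rewrite integralZl//; last first.
  apply/integrable_restrict => //; rewrite setTI.
  exact: integrableS ih.
rewrite fineM//; first by rewrite -integral_mkcond.
by rewrite -integral_mkcond; apply: integrable_fin_num => //; exact: integrableS ih.
Qed.

(** A real-valued integral equals 0 when the extended one is infinite, so positivity requires
    finiteness as well. The integrand is dominated by the kernel up to 1 and by the exponential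
    density beyond; it is bounded below by [expR (- 1)] on []0, 1[]. *)
Lemma Gamma_gt0 (z : R) : 0 < z < 1 -> 0 < Gamma z.
Proof.
move=> /andP[z0 z1].
pose g (t : R) := t `^ (z - 1) * expR (- t).
have g0 t : 0 <= g t by rewrite mulr_ge0 ?powR_ge0 ?expR_ge0.
have mg : measurable_fun setT g.
  apply: measurable_funM; first exact: measurable_powR.
  by apply: measurableT_comp => //; exact: measurable_funN.
pose e (t : R) := exponential_pdf 1 t.
have ie : mu.-integrable setT (EFin \o e) by exact: integrable_exponential_pdf.
have me : measurable_fun setT (fun t => `|(e t)%:E|%E).
  have /integrableP[me _] := ie; exact: measurableT_comp.
have mk : measurable_fun setT (fun t : R => (kern z 1 t)%:E).
  by apply/measurable_EFinP; exact: measurable_kern.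
have fin : (\int[mu]_(t in `]0%R, +oo[) (g t)%:E < +oo)%E.
  apply: (@le_lt_trans _ _ (\int[mu]_t ((kern z 1 t)%:E + `|(e t)%:E|))%E).
    rewrite integral_mkcond; apply: ge0_le_integral => //.
    - by move=> t _; rewrite patchE; case: ifP => // _; rewrite lee_fin.
    - apply/(measurable_restrictT _ _).1 => //; apply/measurable_EFinP.
      exact: measurable_funTS.
    - exact: emeasurable_funD.
    - move=> t _; rewrite patchE mem_setE in_itv/= andbT; case: ifPn => t0; last first.
        by rewrite adde_ge0// lee_fin kern_ge0.
      rewrite -EFinD lee_fin /g /kern t0/=; case: ifPn => t1.
        apply: ler_wpDr => //.
        by rewrite ler_piMr ?powR_ge0// -expR0 ler_expR; lra.
      rewrite add0r /e /exponential_pdf patchE mem_setE in_itv/= (ltW t0)/=.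
      rewrite mul1r mulN1r ger0_norm ?expR_ge0//.
      rewrite ler_piMl ?expR_ge0//.
      have -> : z - 1 = - (1 - z) by ring.
      rewrite powRN invf_le1 ?powR_gt0//.
      have e1 : (1 : R) `^ (1 - z) = 1 by rewrite powR1.
      rewrite -[leLHS]e1; apply: ge0_ler_powR; rewrite ?nnegrE//; lra.
  rewrite ge0_integralD//; last by move=> t _; rewrite lee_fin kern_ge0.
  by apply: lte_add_pinfty; [exact: integral_kern_lty|have /integrableP[_] := ie].
have pos : (0 < \int[mu]_(t in `]0%R, +oo[) (g t)%:E)%E.
  apply: (@lt_le_trans _ _ (\int[mu]_(t in `]0%R, 1%R[) (expR (- 1))%:E)%E).
    rewrite (eq_integral (cst (expR (- 1))%:E))// integral_cst//.
    rewrite [X in (_ * X)%E](_ : _ = 1%E) ?mule1; last exact: lebesgue_measure01.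
    by rewrite lte_fin expR_gt0.
  apply: (@le_trans _ _ (\int[mu]_(t in `]0%R, 1%R[) (g t)%:E)%E).
    apply: ge0_le_integral => //.
    - by apply/measurable_EFinP; exact: measurable_funTS.
    - move=> t /=; rewrite in_itv/= => /andP[t0 t1]; rewrite lee_fin /g.
      rewrite -[leLHS]mul1r ler_pM ?expR_ge0// ?ler_expR; last lra.
      have := @kern_ge1 z t (ltW z1) t0 (ltW t1).
      by rewrite /kern t0 (ltW t1).
  apply: ge0_subset_integral => //.
  - by apply/measurable_EFinP; exact: measurable_funTS.
  - by move=> t _; rewrite lee_fin.
  - by apply: subset_itvl; rewrite bnd_simp.
by rewrite /Gamma /Rintegral fine_gt0// pos fin.
Qed.

End abel.

(** * Square-integrable functions *)

Section square_integrable.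
Context d (T : measurableType d) (R : realType).
Variables (mu : {measure set T -> \bar R}) (D : set T) (mD : measurable D).
Implicit Types f g : T -> R.

Let integrableZl_EFin (k : R) f : mu.-integrable D (fun x => (f x)%:E) ->
  mu.-integrable D (fun x => (k * f x)%:E).
Proof.
move=> fi; have := integrableZl mD k fi.
by apply: eq_integrable => // x _; rewrite EFinM.
Qed.

Definition sq_integrable f :=
  measurable_fun D f /\ mu.-integrable D (fun x => (f x ^+ 2)%:E).

Definition sqnorm f : R := \int[mu]_(x in D) (f x ^+ 2).

Lemma sqnorm_ge0 f : 0 <= sqnorm f.
Proof. by apply: Rintegral_ge0 => x _; exact: sqr_ge0. Qed.

Lemma integrableM_sq f g : sq_integrable f -> sq_integrable g ->
  mu.-integrable D (fun x => (f x * g x)%:E).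
Proof.
move=> [mf if2] [mg ig2].
apply: (@le_integrable _ _ R mu D mD _
  (fun x => ((f x ^+ 2)%:E + (g x ^+ 2)%:E)%E)).
- by apply/measurable_EFinP; exact: measurable_funM.
- move=> x _; rewrite -EFinD !abse_EFin lee_fin.
  rewrite [leRHS]ger0_norm ?addr_ge0 ?sqr_ge0// ler_norml.
  have := sqr_ge0 (f x + g x); have := sqr_ge0 (f x - g x).
  have := sqr_ge0 (f x); have := sqr_ge0 (g x).
  by move=> *; apply/andP; split; nra.
- exact: integrableD.
Qed.

Lemma sq_integrable_lin f g (k l : R) : sq_integrable f -> sq_integrable g ->
  sq_integrable (fun x => k * f x + l * g x).
Proof.
move=> hf hg; have ifg := integrableM_sq hf hg.
case: hf hg => mf if2 [mg ig2]; split.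
  by apply: measurable_funD; exact: measurable_funM.
have : mu.-integrable D (fun x => ((k ^+ 2)%:E * (f x ^+ 2)%:E +
   ((2 * k * l)%:E * (f x * g x)%:E + (l ^+ 2)%:E * (g x ^+ 2)%:E))%E).
  by apply: integrableD => //; [exact: integrableZl|apply: integrableD => //;
    exact: integrableZl].
apply: eq_integrable => // x _; rewrite -!EFinM -!EFinD; congr EFin; ring.
Qed.

Lemma sqnorm_lin f g (k l : R) : sq_integrable f -> sq_integrable g ->
  sqnorm (fun x => k * f x + l * g x) = k ^+ 2 * sqnorm f +
    2 * k * l * (\int[mu]_(x in D) (f x * g x)) + l ^+ 2 * sqnorm g.
Proof.
move=> hf hg; have ifg := integrableM_sq hf hg.
case: hf hg => mf if2 [mg ig2].
rewrite /sqnorm -!RintegralZl//.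
have iD f' g' : mu.-integrable D (fun x => (f' x)%:E) ->
    mu.-integrable D (fun x => (g' x)%:E) ->
    mu.-integrable D (fun x => (f' x + g' x)%:E).
  move=> i j; have := integrableD mD i j.
  by apply: eq_integrable => // x _; rewrite EFinD.
rewrite -RintegralD//; [|exact: integrableZl_EFin..].
rewrite -RintegralD//; [|by apply: iD; exact: integrableZl_EFin|exact: integrableZl_EFin].
by apply: eq_Rintegral => x _; ring.
Qed.

Lemma sq_integrableB f g : sq_integrable f -> sq_integrable g ->
  sq_integrable (f \- g).
Proof.
move=> hf hg; rewrite (_ : f \- g = fun x => 1 * f x + (-1) * g x).
  exact: sq_integrable_lin.
by apply/funext => x /=; ring.
Qed.

Lemma eq_sqnorm f g : {in D, f =1 g} -> sqnorm f = sqnorm g.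
Proof. by move=> fg; apply: eq_Rintegral => x xD; rewrite fg. Qed.

Lemma eq_sq_integrable f g : {in D, f =1 g} -> sq_integrable f -> sq_integrable g.
Proof.
move=> fg [mf if2]; split; first by apply: eq_measurable_fun mf.
by apply: eq_integrable if2 => // x xD; rewrite fg.
Qed.

(** The parallelogram identity is written with the midpoint because midpoints stay in convex
    sublevel sets. *)
Lemma sqnormB f g : sq_integrable f -> sq_integrable g ->
  sqnorm (f \- g) = 2 * sqnorm f + 2 * sqnorm g -
    4 * sqnorm (fun x => 2^-1 * f x + 2^-1 * g x).
Proof.
move=> hf hg.
have -> : sqnorm (f \- g) = sqnorm (fun x => 1 * f x + (-1) * g x).
  by apply: eq_sqnorm => x _ /=; ring.
by rewrite !sqnorm_lin//; field.
Qed.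

Lemma sqnormB_le f g : sq_integrable f -> sq_integrable g ->
  sqnorm (f \- g) <= 2 * sqnorm f + 2 * sqnorm g.
Proof.
by move=> hf hg; rewrite sqnormB// lerBlDr lerDl mulr_ge0 ?sqnorm_ge0.
Qed.

(** The factors 2 are the price of staying with squared norms and avoiding square roots. *)
Lemma sqnorm_triangle f g h : sq_integrable f -> sq_integrable g ->
  sq_integrable h ->
  sqnorm (f \- h) <= 2 * sqnorm (f \- g) + 2 * sqnorm (g \- h).
Proof.
move=> hf hg hh.
have -> : sqnorm (f \- h) = sqnorm ((f \- g) \- (h \- g)).
  by apply: eq_sqnorm => x _ /=; ring.
have -> : sqnorm (g \- h) = sqnorm (h \- g).
  by apply: eq_Rintegral => x _ /=; ring.
by apply: sqnormB_le; exact: sq_integrableB.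
Qed.

Lemma cauchy_schwarz f g : sq_integrable f -> sq_integrable g ->
  (\int[mu]_(x in D) (f x * g x)) ^+ 2 <= sqnorm f * sqnorm g.
Proof.
move=> hf hg; set B := \int[mu]_(x in D) _.
have H t : 0 <= t ^+ 2 * sqnorm f + 2 * t * (-1) * B + (-1) ^+ 2 * sqnorm g.
  by rewrite -sqnorm_lin// sqnorm_ge0.
have := sqnorm_ge0 f; rewrite le_eqVlt => /predU1P[f0|f0].
  have [->|B0] := eqVneq B 0; first by rewrite -f0 mul0r expr0n.
  (* When [f] has norm 0 the quadratic is affine in [t]; this [t] gives it the value -1, a
     contradiction if [B] is nonzero. *)
  have := H ((sqnorm g + 1) / (2 * B)); rewrite -f0 mulr0 add0r.
  have -> : 2 * ((sqnorm g + 1) / (2 * B)) * -1 * B = - (sqnorm g + 1) by field.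
  by lra.
(* This [t] minimizes the quadratic. *)
have := H (B / sqnorm f).
have -> : (B / sqnorm f) ^+ 2 * sqnorm f + 2 * (B / sqnorm f) * -1 * B +
  (-1) ^+ 2 * sqnorm g = (sqnorm f * sqnorm g - B ^+ 2) / sqnorm f.
  by field; rewrite gt_eqF.
by rewrite pmulr_lge0 ?invr_gt0// subr_ge0.
Qed.

End square_integrable.

(** * Completeness of L^2 on a set of finite measure *)

Lemma measurable_fun_limn_einf d (T : measurableType d) (R : realType)
    (D : set T) (f : nat -> T -> \bar R) :
  (forall n, measurable_fun D (f n)) ->
  measurable_fun D (fun x => limn_einf (f ^~ x)).
Proof.
move=> mf.
rewrite (_ : (fun x => _) = \- (fun x => limn_esup (fun n => - f n x)%E))%E.
  apply: measurableT_comp => //; apply: measurable_fun_limn_esup => n.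
  exact: measurableT_comp.
by apply/funext => x; rewrite -[in RHS]limn_einfN /comp; congr limn_einf;
  apply/funext => n /=; rewrite oppeK.
Qed.

Section L2_complete.
Context d (T : measurableType d) (R : realType).
Variables (mu : {measure set T -> \bar R}) (D : set T) (mD : measurable D).
Hypothesis muD : (mu D < +oo)%E.
Local Notation sqi := (sq_integrable mu D).
Local Notation nrm := (sqnorm mu D).

Lemma EFin_sqnorm (f : T -> R) : sqi f ->
  ((nrm f)%:E = \int[mu]_(x in D) (f x ^+ 2)%:E)%E.
Proof. by move=> [_ if2]; rewrite fineK// integrable_fin_num. Qed.

(* [`|d| <= 2^k d^2 + 2^-k] makes the increments summable in L^1, hence
   almost everywhere, once their squared norms are below [4^-k]. *)
Lemma ae_cvg_fast (g : nat -> T -> R) : (forall k, sqi (g k)) ->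
  (forall k, nrm (g k.+1 \- g k) <= 4^-1 ^+ k) ->
  {ae mu, forall x, D x -> cvgn (fun k => g k x)}.
Proof.
move=> sg hg.
pose u k x := (`|g k.+1 x - g k x|)%:E.
have mu_ k : measurable_fun D (u k).
  apply/measurable_EFinP; apply: measurableT_comp => //.
  by apply: measurable_funB; [case: (sg k.+1)|case: (sg k)].
have u0 k x : D x -> (0 <= u k x)%E by move=> _; rewrite lee_fin.
have muDE : mu D = (fine (mu D))%:E by rewrite fineK// ge0_fin_numE.
have intu k : (\int[mu]_(x in D) u k x <= ((1 + fine (mu D)) * 2^-1 ^+ k)%:E)%E.
  apply: (@le_trans _ _ (\int[mu]_(x in D) ((2 ^+ k)%:E * ((g k.+1 x - g k x) ^+ 2)%:E
     + cst (2^-1 ^+ k)%:E x))%E).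
    have mdk : measurable_fun D (fun x => ((g k.+1 x - g k x) ^+ 2)%:E).
      apply/measurable_EFinP; apply: measurable_funX.
      by apply: measurable_funB; [case: (sg k.+1)|case: (sg k)].
    apply: ge0_le_integral => //.
    - exact: u0.
    - by apply: emeasurable_funD => //; exact: emeasurable_funM.
    - move=> x _; rewrite -EFinM -EFinD lee_fin /=.
      set d0 := g k.+1 x - g k x.
      have p0 : 0 < 2 ^+ k :> R by rewrite exprn_gt0.
      have e1 : 2 ^+ k * 2^-1 ^+ k = 1 :> R by rewrite -exprMn divff// expr1n.
      have := sqr_ge0 (2 ^+ k * `|d0| - 1); rewrite -[d0 ^+ 2](real_normK (num_real d0)) => H.
      rewrite -(ler_pM2l p0) mulrDr e1.
      have := normr_ge0 d0; set z := `|d0| in H *; set P := 2 ^+ k in p0 e1 H * => z0.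
      have : 0 <= P * z by apply: mulr_ge0 => //; exact: ltW.
      by nra.
  have mdk2 : measurable_fun D (fun x => ((g k.+1 x - g k x) ^+ 2)%:E).
    apply/measurable_EFinP; apply: measurable_funX.
    by apply: measurable_funB; [case: (sg k.+1)|case: (sg k)].
  have dk0 x : D x -> (0 <= ((g k.+1 x - g k x) ^+ 2)%:E)%E.
    by rewrite lee_fin sqr_ge0.
  have p0 : (0 <= (2 ^+ k)%:E :> \bar R)%E by rewrite lee_fin exprn_ge0.
  rewrite ge0_integralD//; last 3 first.
  - by move=> x Dx; rewrite mule_ge0// dk0.
  - exact: emeasurable_funM.
  - by move=> x _; rewrite lee_fin exprn_ge0.
  rewrite integral_cst// ge0_integralZl//.
  have := EFin_sqnorm (sq_integrableB mD (sg k.+1) (sg k)) => /= <-.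
  rewrite muDE -!EFinM -EFinD lee_fin mulrDl mul1r [fine _ * _]mulrC lerD2r.
  apply: (@le_trans _ _ (2 ^+ k * 4^-1 ^+ k)).
    by rewrite ler_wpM2l ?exprn_ge0.
  by rewrite -exprMn (_ : 2 * 4^-1 = 2^-1)//; field.
have sumu : (\int[mu]_(x in D) (\sum_(0 <= k <oo) u k x) < +oo)%E.
  rewrite integral_nneseries//.
  apply: (@le_lt_trans _ _ (\sum_(0 <= k <oo) ((1 + fine (mu D)) * 2^-1 ^+ k)%:E)%E).
    apply: lee_nneseries => [k _ _|k _]; last exact: intu.
    by apply: integral_ge0 => x; exact: u0.
  rewrite (_ : (\sum_(0 <= k <oo) _)%E =
    (limn (series (geometric (1 + fine (mu D)) 2^-1)))%:E) ?ltry//.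
  rewrite -EFin_lim; last first.
    by apply: is_cvg_geometric_series; rewrite ger0_norm ?invr_ge0//; lra.
  congr (limn _); apply/funext => n /=.
  by rewrite /series/= -sumEFin.
have isum : mu.-integrable D (fun x => (\sum_(0 <= k <oo) u k x)%E).
  apply/integrableP; split; first exact: (@ge0_emeasurable_sum _ _ R D u predT (fun k x Dx _ => u0 k x Dx) (fun k _ => mu_ k)).
  under eq_integral => x /set_mem Dx.
    rewrite gee0_abs; last by apply: nneseries_ge0 => k _ _; exact: u0.
    over.
  exact: sumu.
have := integrable_ae mD isum; apply: filterS => x xfin Dx.
have {}xfin := xfin Dx.
have cd : cvgn (series (telescope (fun k => g k x))).
  apply: normed_cvg; apply: nondecreasing_is_cvgn.
    by apply: nondecreasing_series => k _ _ /=; exact: normr_ge0.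
  exists (fine (\sum_(0 <= k <oo) u k x)%E) => _ [n _ <-].
  rewrite -lee_fin fineK// /series/= -sumEFin.
  by apply: nneseries_lim_ge => k _ _; exact: u0.
rewrite telescopeK in cd.
rewrite (_ : (fun k => g k x) = (fun k => (g k x - g 0 x) + g 0 x)).
  by apply: is_cvgD; [exact: cd|exact: is_cvg_cst].
by apply/funext => k; rewrite subrK.
Qed.

(** The almost everywhere convergent subsequence is part of the conclusion because Fatou's lemma is
    later applied along it. The bound [k <= s k] transfers to it every eventual property of the
    whole sequence. *)
Lemma L2_complete (f_ : nat -> T -> R) : (forall n, sqi (f_ n)) ->
  (forall e, 0 < e -> exists N, forall m n, (N <= m)%N -> (N <= n)%N ->
     nrm (f_ m \- f_ n) < e) ->
  exists f (s : nat -> nat), [/\ sqi f, (forall k, (k <= s k)%N),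
    nrm (f_ n \- f) @[n --> \oo] --> 0 &
    {ae mu, forall x, D x -> f_ (s k) x @[k --> \oo] --> f x}].
Proof.
move=> sf cf.
have q0 k : 0 < 4^-1 ^+ k :> R by rewrite exprn_gt0.
have /choice[N hN] := fun k => cf _ (q0 k).
(* Summing the thresholds makes [s] nondecreasing and at least both [N k] and [k]. *)
pose s k := (k + \sum_(i < k.+1) N i)%N.
have sN k : (N k <= s k)%N by rewrite /s big_ord_recr/= addnA leq_addl.
have ss k : (s k <= s k.+1)%N.
  by rewrite /s [in leqRHS]big_ord_recr/= leq_add// leq_addr.
pose g k := f_ (s k).
have sg k : sqi (g k) by exact: sf.
have hg k : nrm (g k.+1 \- g k) <= 4^-1 ^+ k.
  by apply/ltW/hN => //; exact: leq_trans (ss k).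
have acv := ae_cvg_fast sg hg.
(* The upper limit exists at every point and is measurable; its values off the convergence set are
   irrelevant. *)
pose f x := fine (limn_esup (fun k => (g k x)%:E)).
have fE x : cvgn (fun k => g k x) -> g k x @[k --> \oo] --> f x.
  move=> cg; have cgE : (g k x)%:E @[k --> \oo] --> (limn (fun k => g k x))%:E.
    by apply: cvg_EFin => //; exact: nearW.
  by rewrite /f (cvg_limn_einf_sup cgE).2.
have mf : measurable_fun D f.
  apply: (@measurableT_comp _ _ _ _ _ _ (@fine R)) => //.
  apply: measurable_fun_limn_esup => k.
  by apply/measurable_EFinP; case: (sg k).
(* With [n] fixed, Fatou's lemma along the subsequence bounds the distance from [f_ n] to the limit;
   it also gives square integrability of the difference, and hence of [f]. *)
have key n e : (forall m, (n <= m)%N -> nrm (f_ n \- f_ m) < e) ->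
    sqi (f_ n \- f) /\ nrm (f_ n \- f) <= e.
  move=> hn.
  pose h k x := ((f_ n x - g k x) ^+ 2)%:E.
  have mh k : measurable_fun D (h k).
    apply/measurable_EFinP; apply: measurable_funX.
    by apply: measurable_funB; [case: (sf n)|case: (sg k)].
  have h0 k x : D x -> (0 <= h k x)%E by rewrite lee_fin sqr_ge0.
  have mdf : measurable_fun D (f_ n \- f).
    by apply: measurable_funB => //; case: (sf n).
  have mdf2 : measurable_fun D (fun x => ((f_ n \- f) x ^+ 2)%:E).
    by apply/measurable_EFinP; exact: measurable_funX.
  have le : (\int[mu]_(x in D) ((f_ n \- f) x ^+ 2)%:E <= e%:E)%E.
    apply: (@le_trans _ _ (\int[mu]_(x in D) limn_einf (h ^~ x))%E).
      apply: ae_ge0_le_integral => //.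
      - by move=> x _; rewrite lee_fin sqr_ge0.
      - move=> x Dx; rewrite limn_einf_lim; apply: lime_ge; first exact: is_cvg_einfs.
        by apply: nearW => m; apply: le_ereal_inf_tmp => _ [k _ <-]; exact: h0.
      - by apply: measurable_fun_limn_einf.
      - apply: filterS acv => x /[apply] cx.
        have hx : h k x @[k --> \oo] --> ((f_ n \- f) x ^+ 2)%:E.
          apply: cvg_EFin; first exact: nearW.
          rewrite /h/= /comp/=; apply: cvgM; apply: cvgB (fE _ cx); exact: cvg_cst.
        by rewrite (cvg_limn_einf_sup hx).1.
    apply: (le_trans (fatou mu mD mh h0)).
    rewrite limn_einf_lim; apply: lime_le; first exact: is_cvg_einfs.
    apply: nearW => m; pose k := (maxn m n).
    apply: (@le_trans _ _ (\int[mu]_(x in D) h k x)%E).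
      by apply: ereal_inf_lbound; exists k => //=; exact: leq_maxl.
    have nk : (n <= s k)%N by rewrite (leq_trans (leq_maxr m n))// leq_addr.
    have := hn _ nk; rewrite -lte_fin EFin_sqnorm => [/ltW//|].
    exact: sq_integrableB.
  have sdf : sqi (f_ n \- f).
    split => //; apply/integrableP; split => //.
    under eq_integral do rewrite gee0_abs ?lee_fin ?sqr_ge0//.
    by apply: le_lt_trans le _; rewrite ltry.
  by split => //; rewrite -lee_fin EFin_sqnorm.
exists f, s; split.
- have [N0 hN0] := cf 1 ltr01.
  have [sdf _] := key N0 1 (fun m h => hN0 _ _ (leqnn _) h).
  rewrite (_ : f = f_ N0 \- (f_ N0 \- f)); first exact: sq_integrableB.
  by apply/funext => x /=; rewrite subKr.
- by move=> k; exact: leq_addr.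
- apply/cvgrPdist_le => e e0; have [N0 hN0] := cf e e0.
  near=> n; rewrite sub0r normrN ger0_norm ?sqnorm_ge0//.
  have N0n : (N0 <= n)%N by near: n; exact: nbhs_infty_ge.
  by have [] := key n e (fun m h => hN0 _ _ N0n (leq_trans N0n h)).
- by apply: filterS acv => x /[apply]; exact: fE.
Unshelve. all: by end_near. Qed.

End L2_complete.

(** * Test functions and their Caputo derivatives *)

Section test_functions.
Context {R : realType}.
Local Notation mu := (@lebesgue_measure R).
Variables (a b sigma : R).
Implicit Types (phi psi : R -> R).

Lemma test_derivable phi x : test_function a b phi -> derivable phi x 1.
Proof. by case=> dphi _ _; exact: (dphi 0). Qed.

Lemma test_derivable' phi x : test_function a b phi -> derivable (derive1 phi) x 1.
Proof. by case=> dphi _ _; exact: (dphi 1). Qed.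

Lemma derivable_continuous (f : R -> R) x :
  derivable f x 1 -> {for x, continuous f}.
Proof.
by move=> df; apply: differentiable_continuous; exact/derivable1_diffP.
Qed.

Lemma test_continuous phi : test_function a b phi -> continuous phi.
Proof. by move=> tphi x; exact/derivable_continuous/test_derivable. Qed.

Lemma test_out phi x : test_function a b phi -> x \notin `]a, b[ -> phi x = 0.
Proof.
case=> _ _ sub xab; apply/eqP; apply: contraNT xab => phix.
have := sub x (@subset_closure _ [set x | phi x != 0] x phix).
by rewrite /= inE.
Qed.

Lemma is_deriveM1 (f g : R -> R) (x df dg : R) :
  is_derive x 1 f df -> is_derive x 1 g dg ->
  is_derive x 1 (fun y => f y * g y) (f x * dg + g x * df).
Proof. by move=> hf hg; exact: is_deriveM. Qed.

Lemma is_derive_lin (f g : R -> R) (k l x df dg : R) :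
  is_derive x 1 f df -> is_derive x 1 g dg ->
  is_derive x 1 (fun y => k * f y + l * g y) (k * df + l * dg).
Proof.
move=> hf hg.
have h1 := is_deriveM1 (is_derive_cst k x 1) hf.
have h2 := is_deriveM1 (is_derive_cst l x 1) hg.
by have := is_deriveD h1 h2; rewrite !mulr0 !addr0.
Qed.

Lemma derivable_is_derive1 (f : R -> R) (x : R) :
  derivable f x 1 -> is_derive x 1 f (derive1 f x).
Proof. by move=> df; rewrite derive1E; exact: derivableP. Qed.

Lemma is_derive1_val (f : R -> R) (x df : R) :
  is_derive x 1 f df -> derive1 f x = df.
Proof. by rewrite derive1E => -[]. Qed.

Lemma derive1_lin (f g : R -> R) (k l x : R) : derivable f x 1 -> derivable g x 1 ->
  derive1 (fun y => k * f y + l * g y) x = k * derive1 f x + l * derive1 g x.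
Proof.
by move=> df dg; apply: is_derive1_val;
  apply: is_derive_lin; exact: derivable_is_derive1.
Qed.

Lemma derivable_lin (f g : R -> R) (k l x : R) : derivable f x 1 -> derivable g x 1 ->
  derivable (fun y => k * f y + l * g y) x 1.
Proof.
move=> /derivable_is_derive1 df /derivable_is_derive1 dg.
by have [] := is_derive_lin k l df dg.
Qed.

Lemma derive1n_lin (f g : R -> R) (k l : R) n :
  (forall n x, derivable (derive1n n f) x 1) ->
  (forall n x, derivable (derive1n n g) x 1) ->
  derive1n n (fun y => k * f y + l * g y) =
  (fun y => k * derive1n n f y + l * derive1n n g y).
Proof.
move=> df dg; elim: n => [//|n IH]; rewrite !derive1nS IH; apply/funext => x.
exact: derive1_lin.
Qed.

Lemma test_function_lin phi psi (k l : R) :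
  test_function a b phi -> test_function a b psi ->
  test_function a b (fun x => k * phi x + l * psi x).
Proof.
move=> [d1 c1 s1] [d2 c2 s2].
have sub : closure [set x | k * phi x + l * psi x != 0] `<=`
    closure [set x | phi x != 0] `|` closure [set x | psi x != 0].
  rewrite -closureU; apply: closure_subset => x /= H.
  have [e1|] := eqVneq (phi x) 0; last by left.
  have [e2|] := eqVneq (psi x) 0; last by right.
  by move: H; rewrite e1 e2 !mulr0 addr0 eqxx.
split.
- move=> n x; rewrite (derive1n_lin _ _ _ d1 d2).
  exact: derivable_lin.
- apply: subclosed_compact sub; first exact: closed_closure.
  exact: compactU.
- by move=> x /sub [/s1|/s2].
Qed.

Lemma test_function0 : test_function a b (fun=> 0).
Proof.
have e0 : [set x : R | (0 : R) != 0] = set0.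
  by apply/seteqP; split => // x /=; rewrite eqxx.
split.
- move=> n x; suff -> : derive1n n (fun=> 0 : R) = (fun=> 0 : R).
    exact: derivable_cst.
  elim: n => // n IH; rewrite derive1nS IH; apply/funext => y.
  exact: derive1_cst.
- by rewrite e0 closure0; exact: compact0.
- by rewrite e0 closure0.
Qed.

Definition tempered phi r : R := expR (sigma * r) * phi r.

Lemma is_derive_expRM (k x : R) :
  is_derive x 1 (fun r : R => expR (k * r)) (expR (k * x) * k).
Proof.
have dk : is_derive x 1 (fun r : R => k * r) k.
  by apply: is_derive_eq; rewrite /GRing.scale/= ?mulr1 ?mulr0 ?addr0.
exact: (@is_derive1_comp _ expR (fun r : R => k * r) x _ _ _ dk).
Qed.

Lemma derivable_expRM (k x : R) : derivable (fun r : R => expR (k * r)) x 1.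
Proof. by have [] := is_derive_expRM k x. Qed.

Lemma continuous_expRM (k : R) : continuous (fun r : R => expR (k * r)).
Proof. by move=> x; exact/derivable_continuous/derivable_expRM. Qed.

Lemma is_derive_tempered phi x : derivable phi x 1 ->
  is_derive x 1 (tempered phi)
    (expR (sigma * x) * derive1 phi x + phi x * (expR (sigma * x) * sigma)).
Proof.
move=> /derivable_is_derive1 dphi.
exact: is_deriveM1 (is_derive_expRM sigma x) dphi.
Qed.

Lemma derivable_tempered phi x : derivable phi x 1 -> derivable (tempered phi) x 1.
Proof. by move=> /is_derive_tempered[]. Qed.

Lemma continuous_tempered phi : continuous phi -> continuous (tempered phi).
Proof. move=> c x; apply: (@continuousM _ _ (fun r => expR (sigma * r)) phi).
  exact: continuous_expRM.
exact: c. Qed.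

Lemma derive1_tempered_continuous phi : test_function a b phi ->
  continuous (derive1 (tempered phi)).
Proof.
move=> tphi; rewrite (_ : derive1 _ = fun r =>
    expR (sigma * r) * derive1 phi r + phi r * (expR (sigma * r) * sigma)).
  move=> x; apply: (@continuousD _ _ _ (fun r => expR (sigma * r) * derive1 phi r)
    (fun r => phi r * (expR (sigma * r) * sigma))).
    apply: (@continuousM _ _ (fun r => expR (sigma * r))); first exact: continuous_expRM.
    exact/derivable_continuous/test_derivable'.
  apply: (@continuousM _ _ phi); first exact: test_continuous.
  apply: (@continuousM _ _ (fun r => expR (sigma * r)) (cst sigma)).
    exact: continuous_expRM.
  exact: cst_continuous.
apply/funext => r; apply: is_derive1_val; apply: is_derive_tempered.
exact: test_derivable.
Qed.

End test_functions.

(** * Caputo derivatives as Abel convolutions *)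

Section caputo_representation.
Context {R : realType}.
Local Notation mu := (@lebesgue_measure R).
Variables (a b alpha sigma : R).
Hypotheses (ab : a < b) (al01 : 0 < alpha < 1).
Implicit Types (phi psi : R -> R).

Lemma integrable_patch_bounded (h : R -> R) (B : R) :
  measurable_fun setT (h \_ `[a, b]) -> (forall s, `|(h \_ `[a, b]) s| <= B) ->
  mu.-integrable setT (EFin \o h \_ `[a, b]).
Proof.
move=> mh hB; rewrite -restrict_EFin.
apply/integrable_restrict => //; rewrite setTI.
apply: measurable_bounded_integrable => //.
- by rewrite /= lebesgue_measure_itv/= lte_fin ab -EFinD ltry.
- exact/measurable_restrictT.
- exists B; split; first exact: num_real.
  move=> M BM x /= xab; apply: le_trans (ltW BM).
  by have := hB x; rewrite patchE mem_set.
Qed.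

Lemma continuous_patch (f : R -> R) : continuous f ->
  [/\ measurable_fun setT (f \_ `[a, b]),
      (exists B, forall s, `|(f \_ `[a, b]) s| <= B) &
      mu.-integrable setT (EFin \o f \_ `[a, b])].
Proof.
move=> cf.
have mf : measurable_fun setT (f \_ `[a, b]).
  apply: (measurable_restrictT f _).1 => //; apply: measurable_funTS.
  exact: continuous_measurable_fun.
have [B hB] : exists B, forall s, `|(f \_ `[a, b]) s| <= B.
  have /compact_bounded[M [_ hM]] : compact (f @` `[a, b]).
    apply: continuous_compact; last exact: segment_compact.
    exact: continuous_subspaceT.
  exists (`|M| + 1) => s; rewrite patchE; case: ifPn => [/set_mem sab|_].
    apply: (hM (`|M| + 1)); last by exists s.
    by rewrite (le_lt_trans (ler_norm _))// ltrDl.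
  by rewrite normr0 addr_ge0.
by split => //; [exists B|exact: integrable_patch_bounded hB].
Qed.

Definition source phi : R -> R := derive1 (tempered sigma phi) \_ `[a, b].

Let q01 : 0 < 1 - alpha < 1.
Proof. by move/andP: al01 => [? ?]; apply/andP; split; lra. Qed.

Let q0 : 0 < 1 - alpha. Proof. by case/andP: q01. Qed.

Lemma caputoE phi x : x \in `[a, b] ->
  caputo a alpha sigma phi x =
  expR (- (sigma * x)) / Gamma (1 - alpha) *
  kern_conv (1 - alpha) (b - a) (source phi) x.
Proof.
rewrite in_itv/= => /andP[ax xb]; rewrite /caputo; congr (_ * _).
rewrite Rintegral_mkcond /kern_conv; apply: eq_Rintegral => s _.
rewrite patchE mem_setE in_itv/= /source patchE mem_setE in_itv/= /kern subr_gt0.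
have [as_|sa] := leP a s; last by rewrite /= mulr0.
have [sx|xs|->] := ltgtP s x => /=.
- rewrite (ltW (lt_le_trans sx xb)).
  have -> : x - s <= b - a by lra.
  by rewrite (_ : 1 - alpha - 1 = - alpha)//; ring.
- by rewrite mul0r.
(* At [s = x] the power of 0 with a nonzero exponent is 0 by convention, in agreement with the
   kernel, which vanishes at 0. *)
- rewrite subrr powR0 ?mul0r// oppr_eq0 gt_eqF//.
  by case/andP: al01.
Qed.

(** The fundamental theorem of calculus; the boundary term at [a] is 0 because [phi] is supported
    inside the open interval. *)
Lemma source_integral phi y : test_function a b phi -> y \in `[a, b] ->
  \int[mu]_(s in `]-oo, y[) source phi s = tempered sigma phi y.
Proof.
move=> tphi; rewrite in_itv/= => /andP[ay yb].
have fa : tempered sigma phi a = 0.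
  by rewrite /tempered (test_out tphi) ?mulr0// in_itv/= ltxx.
have cf' := @derive1_tempered_continuous R a b sigma phi tphi.
have df x : derivable (tempered sigma phi) x 1.
  by apply: derivable_tempered; exact: test_derivable tphi.
move: ay; rewrite le_eqVlt => /predU1P[<-|ay].
  rewrite fa /Rintegral integral0_eq// => s /=; rewrite in_itv/= => sa.
  by rewrite /source patchE mem_setE in_itv/= leNgt sa.
have -> : \int[mu]_(s in `]-oo, y[) source phi s =
    \int[mu]_(s in `[a, y]) derive1 (tempered sigma phi) s.
  rewrite -(@Rintegral_itv_bndo_bndc _ (BLeft a)); last first.
    apply: (@integrableS _ _ _ mu `[a, y]) => //.
      by apply: subset_itvl; rewrite bnd_simp.
    apply: continuous_compact_integrable; first exact: segment_compact.
    exact: (continuous_subspaceT cf').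
  rewrite Rintegral_mkcond [RHS]Rintegral_mkcond; apply: eq_Rintegral => s _.
  rewrite !patchE !mem_setE !in_itv/=.
  have [sy|sy] := ltP s y; last by rewrite andbF.
  by rewrite andbT /source patchE mem_setE in_itv/= (le_trans (ltW sy) yb) andbT.
have cf x : {for x, continuous (tempered sigma phi)} by exact: derivable_continuous.
have dLR : derivable_oo_LRcontinuous (tempered sigma phi) a y.
  split; [by move=> ? _; exact: df|exact: cvg_at_right_filter (cf a)|
    exact: cvg_at_left_filter (cf y)].
rewrite /Rintegral (continuous_FTC2 ay (continuous_subspaceT cf') dLR) => [|//].
by rewrite fa sube0.
Qed.

Lemma source_facts phi : test_function a b phi ->
  [/\ measurable_fun setT (source phi),
      (exists B, forall s, `|source phi s| <= B) &
      mu.-integrable setT (EFin \o source phi)].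
Proof.
move=> tphi; apply: continuous_patch.
exact: (derive1_tempered_continuous (a := a) (b := b)).
Qed.

(* The Caputo derivative without its factor [e^(- sigma x) / Gamma (1 - alpha)]. *)
Definition frac_source phi : R -> R := kern_conv (1 - alpha) (b - a) (source phi).

Lemma frac_source_left phi x : x <= a -> frac_source phi x = 0.
Proof.
move=> xa; rewrite /frac_source /kern_conv /Rintegral integral0_eq// => s _.
rewrite /source patchE mem_setE in_itv/= /kern.
have [as_|_] := leP a s; last by rewrite mulr0.
by rewrite subr_gt0 ltNge (le_trans xa as_)/= mul0r.
Qed.

Definition weighted_caputo phi : R -> R :=
  (fun r => expR (sigma * r) * caputo a alpha sigma phi r) \_ `[a, b].

Let C := (Gamma (1 - alpha))^-1.

Lemma weighted_caputoE phi : weighted_caputo phi = (fun r => C * frac_source phi r) \_ `[a, b].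
Proof.
apply/funext => r; rewrite /weighted_caputo !patchE; case: ifPn => // /set_mem/= rab.
rewrite caputoE// -/(frac_source phi) mulrA mulrA -expRD addrN expR0 mul1r.
by [].
Qed.

Lemma weighted_caputo_facts phi : test_function a b phi ->
  [/\ measurable_fun setT (weighted_caputo phi),
      (exists B, forall s, `|weighted_caputo phi s| <= B) &
      mu.-integrable setT (EFin \o weighted_caputo phi)].
Proof.
move=> tphi; have [mg [B hB] ig] := source_facts tphi.
have mW : measurable_fun setT (weighted_caputo phi).
  rewrite weighted_caputoE; apply: (measurable_restrictT _ _).1 => //.
  apply: measurable_funTS; apply: measurable_funM => //.
  exact: measurable_kern_conv.
have hW s : `|weighted_caputo phi s| <= `|C| * (B * kern_mass (1 - alpha) (b - a)).
  have H x := kern_conv_bounded (b - a) x q0 mg hB.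
  rewrite weighted_caputoE patchE; case: ifPn => _.
    by rewrite normrM ler_wpM2l//; exact: H.
  rewrite normr0 mulr_ge0// mulr_ge0 ?kern_mass_ge0//.
  exact: le_trans (hB 0).
split => //; first by eexists; exact: hW.
exact: integrable_patch_bounded hW.
Qed.

(** Classically this is Gamma(alpha), since B(alpha, 1 - alpha) = Gamma(alpha) Gamma(1 - alpha). *)
Definition abel_const : R := C * fine (beta_mass (1 - alpha)).

Lemma abel_const_gt0 : 0 < abel_const.
Proof.
rewrite mulr_gt0 ?invr_gt0 ?Gamma_gt0// fine_gt0//.
by rewrite beta_mass_lty// andbT (lt_le_trans _ (beta_mass_ge1 q01))//.
Qed.

(* Up to constants and exponential weights, the integral of order [alpha] of the
   Caputo derivative of [phi] is [phi]. *)
Lemma kern_conv_weighted_caputo phi y : test_function a b phi -> y \in `[a, b] ->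
  kern_conv alpha (b - a) (weighted_caputo phi) y = abel_const * tempered sigma phi y.
Proof.
move=> tphi yab; have [mg [B hB] ig] := source_facts tphi.
have [mW [BW hW] iW] := weighted_caputo_facts tphi.
have HV x := kern_conv_bounded (b - a) x q0 mg hB.
have gout s : s < y - (b - a) -> source phi s = 0.
  move: yab; rewrite in_itv/= => /andP[ay yb] sy.
  by rewrite /source patchE mem_setE in_itv/= leNgt (_ : s < a)//; lra.
have := kern_conv_kern_conv q01 ig hB gout.
rewrite source_integral// (_ : 1 - (1 - alpha) = alpha); last by ring.
rewrite /abel_const -mulrA => <-.
rewrite {1}/kern_conv -RintegralZl//; last first.
  apply: integrable_kernM HV; first by case/andP: al01.
  exact: measurable_kern_conv.
(* Restricting to [[a, b]] does not change the convolution at [y]: left of [a] the function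
   [frac_source] vanishes, and right of [b] the kernel does, since [y <= b]. *)
apply: eq_Rintegral => s _; rewrite weighted_caputoE patchE mem_setE in_itv/=.
move: yab; rewrite in_itv/= => /andP[ay yb].
rewrite mulrCA; case: ifPn => [//|].
have [as_|sa _] := leP a s => /=; last by rewrite -/(frac_source phi s) frac_source_left ?mulr0// ltW.
by rewrite -ltNge => bs; rewrite /kern subr_gt0 ltNge (le_trans yb (ltW bs))/= !mul0r.
Qed.

(** Abel's inversion is applied to the weighted derivative, whose convolution of order [alpha] is
    already known. The right-hand side involves the values of [phi] and not its derivative, so it
    passes to uniform limits; this is the basis of closability. *)
Lemma integral_weighted_caputo phi y : test_function a b phi -> y \in `[a, b] ->
  fine (beta_mass alpha) * (\int[mu]_(s in `]-oo, y[) weighted_caputo phi s) =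
  abel_const * kern_conv (1 - alpha) (b - a) (tempered sigma phi \_ `[a, b]) y.
Proof.
move=> tphi yab; have [mW [B hB] iW] := weighted_caputo_facts tphi.
have Wout s : s < y - (b - a) -> weighted_caputo phi s = 0.
  move: yab; rewrite in_itv/= => /andP[ay yb] sy.
  by rewrite /weighted_caputo patchE mem_setE in_itv/= leNgt (_ : s < a)//; lra.
rewrite -(kern_conv_kern_conv al01 iW hB Wout).
have cT : continuous (tempered sigma phi).
  by apply: continuous_tempered => x; exact: (test_continuous tphi).
have [mf [Bf hf] _] := continuous_patch cT.
rewrite [RHS](_ : _ = abel_const * \int[mu]_s (kern (1 - alpha) (b - a) (y - s) *
   (tempered sigma phi \_ `[a, b]) s))//.
rewrite -RintegralZl//; last exact: integrable_kernM hf.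
apply: eq_Rintegral => s _.
move: (yab); rewrite in_itv/= => /andP[ay yb].
rewrite patchE; case: ifPn => [/set_mem/= sab|].
  by rewrite (kern_conv_weighted_caputo tphi)// mulrCA.
rewrite !mulr0 mem_setE in_itv/=.
have [as_|sa _] := leP a s => /=.
  by rewrite -ltNge => bs; rewrite /kern subr_gt0 ltNge (le_trans yb (ltW bs))/= mul0r.
rewrite [X in _ * X](_ : _ = 0) ?mulr0//.
rewrite /kern_conv /Rintegral integral0_eq// => r _.
rewrite /weighted_caputo patchE mem_setE in_itv/= /kern.
have [ar|_] := leP a r; last by rewrite mulr0.
by rewrite subr_gt0 ltNge (le_trans (ltW sa) ar)/= mul0r.
Qed.

End caputo_representation.

(** * Sup norm bound through the Caputo derivative *)

Section caputo_bounds.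
Context {R : realType}.
Local Notation mu := (@lebesgue_measure R).
Variables (a b alpha sigma : R).
Hypotheses (ab : a < b) (al : 2^-1 < alpha < 1).
Implicit Types (phi psi : R -> R).
Local Notation sqi := (sq_integrable mu `[a, b]).
Local Notation nrm := (sqnorm mu `[a, b]).
Local Notation cap := (caputo a alpha sigma).

Let al01 : 0 < alpha < 1.
Proof. by move/andP: al => [h1 h2]; apply/andP; split; lra. Qed.

Let q0 : 0 < 1 - alpha. Proof. by case/andP: al01; lra. Qed.

Definition exp_bound : R := expR (`|sigma| * (`|a| + `|b|)).

Lemma expR_le_bound r : r \in `[a, b] -> expR (sigma * r) <= exp_bound.
Proof.
rewrite in_itv/= => /andP[ar rb]; rewrite ler_expR.
apply: (le_trans (ler_norm _)); rewrite normrM ler_wpM2l//.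
have := ler_norm b; have := ler_norm (- a); rewrite normrN => ha hb.
have := normr_ge0 a; have := normr_ge0 b => b0 a0.
by rewrite ler_norml; apply/andP; split; lra.
Qed.

Lemma expRN_le_bound r : r \in `[a, b] -> expR (- (sigma * r)) <= exp_bound.
Proof.
rewrite in_itv/= => /andP[ar rb]; rewrite ler_expR.
apply: (le_trans (ler_norm _)); rewrite normrN normrM ler_wpM2l//.
have := ler_norm b; have := ler_norm (- a); rewrite normrN => ha hb.
have := normr_ge0 a; have := normr_ge0 b => b0 a0.
by rewrite ler_norml; apply/andP; split; lra.
Qed.

Lemma caputo_weighted phi x : x \in `[a, b] ->
  cap phi x = expR (- (sigma * x)) * weighted_caputo a b alpha sigma phi x.
Proof.
move=> xab; rewrite /weighted_caputo patchE mem_set//.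
by rewrite mulrA -expRD addNr expR0 mul1r.
Qed.

Lemma sq_integrable_bounded (f : R -> R) (B : R) : measurable_fun `[a, b] f ->
  (forall x, x \in `[a, b] -> `|f x| <= B) -> sqi f.
Proof.
move=> mf fB; split => //; apply: measurable_bounded_integrable => //.
- by rewrite /= lebesgue_measure_itv/= lte_fin ab -EFinD ltry.
- exact: measurable_funX.
- exists (B ^+ 2); split; first exact: num_real.
  move=> M BM x /= xab; apply: le_trans (ltW BM).
  by rewrite normrX lerXn2r ?nnegrE ?fB// (le_trans _ (fB x xab)).
Qed.

Lemma sq_integrable_caputo phi : test_function a b phi -> sqi (cap phi).
Proof.
move=> tphi; have [mW [B hB] iW] := weighted_caputo_facts sigma ab al01 tphi.
apply: (@eq_sq_integrable _ _ R mu _ _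
   (fun x => expR (- sigma * x) * weighted_caputo a b alpha sigma phi x)) => //.
  by move=> x; rewrite inE => xab; rewrite caputo_weighted //= mulNr.
apply: (@sq_integrable_bounded _ (exp_bound * B)).
  apply: measurable_funTS; apply: measurable_funM => //.
  by apply: continuous_measurable_fun => x; exact: continuous_expRM.
move=> x xab; rewrite normrM ler_pM// ger0_norm ?expR_ge0// mulNr.
exact: expRN_le_bound.
Qed.

Lemma kern_conv_lin (p T : R) (h1 h2 : R -> R) (B1 B2 k l x : R) : 0 < p ->
  measurable_fun setT h1 -> (forall s, `|h1 s| <= B1) ->
  measurable_fun setT h2 -> (forall s, `|h2 s| <= B2) ->
  kern_conv p T (fun s => k * h1 s + l * h2 s) x =
  k * kern_conv p T h1 x + l * kern_conv p T h2 x.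
Proof.
move=> p0 m1 b1 m2 b2; rewrite /kern_conv.
have i1 := integrable_kernM T x p0 m1 b1; have i2 := integrable_kernM T x p0 m2 b2.
have iZ (c : R) (h : R -> R) : mu.-integrable setT (EFin \o h) ->
    mu.-integrable setT (EFin \o (fun s => c * h s)).
  move=> ih; have := integrableZl (measurableT) c ih.
  by apply: eq_integrable => // s _; rewrite /= EFinM.
rewrite -!RintegralZl// -RintegralD//; [|exact: iZ..].
by apply: eq_Rintegral => s _; ring.
Qed.

Lemma caputo_lin phi psi (k l x : R) : test_function a b phi ->
  test_function a b psi -> x \in `[a, b] ->
  cap (fun y => k * phi y + l * psi y) x = k * cap phi x + l * cap psi x.
Proof.
move=> tphi tpsi xab; rewrite !(@caputoE R a b alpha sigma al01)//.
have [m1 [B1 b1] _] := source_facts sigma ab tphi.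
have [m2 [B2 b2] _] := source_facts sigma ab tpsi.
rewrite [X in kern_conv _ _ X x](_ : _ = fun s =>
  k * source a b sigma phi s +
  l * source a b sigma psi s).
  rewrite (kern_conv_lin _ _ _ _ q0 m1 b1 m2 b2).
  have alg (c m n u v : R) : c * (m * u + n * v) = m * (c * u) + n * (c * v) by ring.
  exact: alg.
apply/funext => s; rewrite /source !patchE; case: ifPn => _; last first.
  by rewrite -[point]/(0 : R) !mulr0 addr0.
rewrite (_ : tempered sigma _ = fun y => k * tempered sigma phi y + l * tempered sigma psi y).
  by apply: derive1_lin; apply: derivable_tempered;
    [exact: test_derivable tphi|exact: test_derivable tpsi].
by apply/funext => y; rewrite /tempered; ring.
Qed.

Lemma kern_sqr (T z : R) : kern alpha T z ^+ 2 = kern (2 * alpha - 1) T z.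
Proof.
rewrite /kern; case: ifPn => [/andP[z0 _]|_]; last by rewrite expr0n.
rewrite expr2 -powRD; last by rewrite (gt_eqF z0) implybT.
by congr (_ `^ _); ring.
Qed.

Lemma test_sup_bound : exists2 M, 0 <= M & forall phi y, test_function a b phi ->
  y \in `[a, b] -> phi y ^+ 2 <= M * nrm (cap phi).
Proof.
have Ac0 := abel_const_gt0 al01.
set A := abel_const alpha in Ac0.
pose K := kern_mass (2 * alpha - 1) (b - a).
have p2 : 0 < 2 * alpha - 1 by move/andP: al => [? ?]; lra.
have E0 : 0 <= exp_bound by exact: expR_ge0.
(* [K] is the squared L^2 norm of the kernel and [A] the constant in Abel's identity. One factor
   [exp_bound ^+ 2] removes the weight from [phi y], the other from the Caputo derivative. *)
exists (exp_bound ^+ 2 * (exp_bound ^+ 2 * K / A ^+ 2)).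
  by rewrite !mulr_ge0 ?sqr_ge0 ?kern_mass_ge0 ?invr_ge0 ?sqr_ge0.
move=> phi y tphi yab.
have [mW [B hB] iW] := weighted_caputo_facts sigma ab al01 tphi.
set W := weighted_caputo a b alpha sigma phi in mW hB iW.
have sk : sq_integrable mu setT (fun s => kern alpha (b - a) (y - s)).
  split; first exact: measurable_kern_shift.
  under eq_fun do rewrite kern_sqr.
  exact: integrable_kern_shift.
have sW : sq_integrable mu setT W.
  split => //; have : mu.-integrable setT (fun x => (B%:E * (W x)%:E)%E).
    exact: integrableZl.
  apply: le_integrable => //.
    by apply/measurable_EFinP; exact: measurable_funX.
  move=> x _; rewrite -EFinM !abse_EFin lee_fin normrX normrM expr2 ler_wpM2r//.
  exact: le_trans (hB x) (ler_norm _).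
have := cauchy_schwarz measurableT sk sW.
rewrite -/(kern_conv alpha (b - a) W y) kern_conv_weighted_caputo// -/A.
have -> : sqnorm mu setT (fun s => kern alpha (b - a) (y - s)) = K.
  rewrite /K /kern_mass /sqnorm /Rintegral -(integral_kern_shift _ _ y).
  by congr fine; apply: eq_integral => s _; rewrite kern_sqr.
have WE : sqnorm mu setT W <= exp_bound ^+ 2 * nrm (cap phi).
  have [mc ic] := sq_integrable_caputo tphi.
  rewrite /sqnorm -RintegralZl// [leRHS]Rintegral_mkcond; apply: le_Rintegral => //.
  - by case: sW.
  - rewrite -restrict_EFin; apply/integrable_restrict => //; rewrite setTI.
    have := @integrableZl _ _ R mu `[a, b]%classic (measurable_itv _) (exp_bound ^+ 2) _ ic.
    by apply: eq_integrable => // x _; rewrite -EFinM.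
  - move=> s _; rewrite /W /weighted_caputo !patchE; case: ifPn => [/set_mem sab|_].
      rewrite exprMn ler_wpM2r ?sqr_ge0// lerXn2r ?nnegrE ?expR_ge0//.
      exact: expR_le_bound.
    by rewrite expr0n.
move=> CS.
have phiE : phi y = expR (- (sigma * y)) * tempered sigma phi y.
  by rewrite /tempered mulrA -expRD addNr expR0 mul1r.
rewrite phiE exprMn -[leRHS]mulrA; apply: ler_pM; rewrite ?sqr_ge0//.
  by rewrite lerXn2r ?nnegrE ?expR_ge0// expRN_le_bound.
rewrite mulrAC ler_pdivlMr ?exprn_gt0// mulrC -exprMn.
apply: (le_trans CS); rewrite mulrAC [leRHS]mulrC ler_wpM2l ?kern_mass_ge0//.
Qed.

End caputo_bounds.

(** * Closability in L^2 *)

Section closability.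
Context {R : realType}.
Local Notation mu := (@lebesgue_measure R).

(** Lebesgue differentiation recovers [w] almost everywhere as the derivative of its primitive. *)
Lemma ae_eq0_of_primitive (w : R -> R) : mu.-integrable setT (EFin \o w) ->
  (forall y, \int[mu]_(s in `]-oo, y]) w s = 0) -> {ae mu, forall x, w x = 0}.
Proof.
move=> iw w0.
have loc : locally_integrable setT w.
  by apply: open_integrable_locally => //; exact: openT.
have iwy y : mu.-integrable `]-oo, y] (EFin \o w) by exact: integrableS iw.
have := FTC1Ny iwy loc; apply: ae_imply => x [_ <-].
rewrite (_ : (fun x => _) = cst 0) ?derive1_cst//.
by apply/funext => y; exact: w0.
Qed.

Variables (a b alpha sigma : R).
Hypotheses (ab : a < b) (al : 2^-1 < alpha < 1).
Local Notation sqi := (sq_integrable mu `[a, b]).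
Local Notation nrm := (sqnorm mu `[a, b]).
Local Notation cap := (caputo a alpha sigma).

Let al01 : 0 < alpha < 1.
Proof. by move/andP: al => [h1 h2]; apply/andP; split; lra. Qed.

Let q0 : 0 < 1 - alpha. Proof. by case/andP: al01; lra. Qed.

(** Pairing with this function in L^2 gives the primitive at [y] of the weighted function, so
    primitives pass to L^2 limits by Cauchy-Schwarz. *)
Let step (y r : R) : R := (r < y)%R%:R * expR (sigma * r).

Let sq_step y : sqi (step y).
Proof.
apply: (@sq_integrable_bounded _ a b ab _ (exp_bound a b sigma)).
  apply: measurable_funTS; apply: measurable_funM.
    apply: (@measurableT_comp _ _ _ _ _ _ (fun t : bool => t%:R : R)) => //.
    exact: measurable_fun_ltr.
  by apply: continuous_measurable_fun => x; exact: continuous_expRM.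
move=> x xab; rewrite /step ger0_norm ?mulr_ge0 ?expR_ge0//.
case: (x < y); rewrite ?mul1r ?mul0r ?expR_ge0//.
exact: expR_le_bound.
Qed.

Let step_integral (u : R -> R) y :
  \int[mu]_(s in `]-oo, y[) ((fun r => expR (sigma * r) * u r) \_ `[a, b]) s =
  \int[mu]_(s in `[a, b]) (step y s * u s).
Proof.
rewrite Rintegral_mkcond [RHS]Rintegral_mkcond; apply: eq_Rintegral => s _.
rewrite !patchE !mem_setE !in_itv/= /step.
by case: ltP => // _; case: ifP => // _; rewrite ?mul1r ?mul0r.
Qed.

(* All primitives of the weighted limit [v] vanish, because by Abel's inversion
   they are limits of integrals of order [1 - alpha] of [phi_ n]. *)
Lemma caputo_closable (phi_ : nat -> R -> R) (v : R -> R) :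
  (forall n, test_function a b (phi_ n)) -> sqi v ->
  (forall e, 0 < e -> exists N, forall n, (N <= n)%N -> forall x, x \in `[a, b] ->
     `|phi_ n x| <= e) ->
  nrm (cap (phi_ n) \- v) @[n --> \oo] --> 0 ->
  {ae mu, forall x, x \in `[a, b] -> v x = 0}.
Proof.
move=> tphi sv phi0 cv.
pose w := (fun r => expR (sigma * r) * v r) \_ `[a, b].
have sc n : sqi (cap (phi_ n)) by exact: sq_integrable_caputo.
have E0 : 0 < exp_bound a b sigma by exact: expR_gt0.
have iw : mu.-integrable setT (EFin \o w).
  rewrite /w -restrict_EFin; apply/integrable_restrict => //; rewrite setTI.
  apply: (@integrableM_sq _ _ R mu _ _ (fun r => expR (sigma * r)) v) => //.
  apply: (@sq_integrable_bounded _ a b ab _ (exp_bound a b sigma)).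
    apply: measurable_funTS.
    by apply: continuous_measurable_fun => x; exact: continuous_expRM.
  by move=> x xab; rewrite ger0_norm ?expR_ge0//; exact: expR_le_bound.
have w0 y : y \in `[a, b] -> \int[mu]_(s in `]-oo, y[) w s = 0.
  move=> yab.
  pose kap := fine (beta_mass alpha).
  have kap0 : 0 < kap.
    rewrite fine_gt0// beta_mass_lty// andbT.
    by rewrite (lt_le_trans _ (beta_mass_ge1 al01)).
  pose A := abel_const alpha.
  have A0 : 0 < A by exact: abel_const_gt0.
  pose K := kern_mass (1 - alpha) (b - a).
  have K0 : 0 <= K by exact: kern_mass_ge0.
  pose Q := A * (exp_bound a b sigma * K).
  have Q0 : 0 <= Q.
    by apply: mulr_ge0; [exact: ltW|apply: mulr_ge0 => //; exact: ltW].
  (* First limit: Abel's inversion expresses these integrals through [phi_ n], which tends to 0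
     uniformly. The [+ 1] in [Q + 1] keeps the denominator positive. *)
  have conv1 : \int[mu]_(s in `[a, b]) (step y s * cap (phi_ n) s) @[n --> \oo] --> 0.
    apply/cvgrPdist_le => e e0.
    have e'0 : 0 < e * kap / (Q + 1) by rewrite divr_gt0 ?mulr_gt0// ltr_wpDl.
    have [N hN] := phi0 _ e'0.
    near=> n; rewrite sub0r normrN.
    have Nn : (N <= n)%N by near: n; exact: nbhs_infty_ge.
    rewrite -step_integral -/(weighted_caputo a b alpha sigma (phi_ n)).
    rewrite -(ler_pM2l kap0) -[X in X * `|_|]gtr0_norm// -normrM.
    rewrite integral_weighted_caputo//.
    have cT : continuous (tempered sigma (phi_ n)).
      by apply: continuous_tempered => x; exact: (test_continuous (tphi n)).
    have [mf _ _] := continuous_patch ab cT.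
    have hf s : `|(tempered sigma (phi_ n) \_ `[a, b]) s| <=
        exp_bound a b sigma * (e * kap / (Q + 1)).
      rewrite patchE; case: ifPn => [/set_mem sab|_].
        rewrite /tempered normrM ler_pM ?hN// ger0_norm ?expR_ge0//.
        exact: expR_le_bound.
      by rewrite normr0; apply: mulr_ge0; exact: ltW.
    rewrite normrM (gtr0_norm A0).
    apply: (@le_trans _ _ (A * (exp_bound a b sigma * (e * kap / (Q + 1)) * K))).
      by rewrite ler_pM2l//; exact: kern_conv_bounded hf.
    have -> : A * (exp_bound a b sigma * (e * kap / (Q + 1)) * K) =
      (Q / (Q + 1)) * (kap * e) by rewrite /Q; ring.
    apply: ler_piMl; first by apply: mulr_ge0; exact: ltW.
    by rewrite ler_pdivrMr ?mul1r ?lerDl// ltr_wpDl.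
  (* Second limit of the same integrals, by L^2 convergence of the derivatives. *)
  have conv2 : \int[mu]_(s in `[a, b]) (step y s * cap (phi_ n) s) @[n --> \oo] -->
      \int[mu]_(s in `[a, b]) (step y s * v s).
    apply/cvgrPdist_lt => e e0.
    have S0 : 0 <= nrm (step y) by exact: sqnorm_ge0.
    have [N _ hN] : \forall n \near \oo, nrm (cap (phi_ n) \- v) < e ^+ 2 / (nrm (step y) + 1).
      have /cvgrPdist_lt/(_ (e ^+ 2 / (nrm (step y) + 1))) := cv.
      rewrite divr_gt0 ?exprn_gt0 ?ltr_wpDl// => /(_ isT); apply: filterS => n.
      by rewrite sub0r normrN ger0_norm ?sqnorm_ge0.
    exists N => // n /= Nn; have {}hN := hN n Nn.
    rewrite distrC -RintegralB//; [|exact: integrableM_sq..].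
    rewrite (_ : \int[mu]_(s in _) _ =
      \int[mu]_(s in `[a, b]) (step y s * (cap (phi_ n) \- v) s)); last first.
      by apply: eq_Rintegral => s _ /=; ring.
    have sd := @sq_integrableB _ _ R mu _ (measurable_itv _) _ _ (sc n) sv.
    have CS := @cauchy_schwarz _ _ R mu _ (measurable_itv _) _ _ (sq_step y) sd.
    set I := \int[mu]_(s in _) _; rewrite ltNge; apply/negP => eI.
    have : e ^+ 2 <= I ^+ 2.
      rewrite -[I ^+ 2]real_normK ?num_real// lerXn2r ?nnegrE//; exact: ltW.
    apply/negP; rewrite -ltNge; apply: (le_lt_trans CS).
    apply: (@le_lt_trans _ _ ((nrm (step y) + 1) * nrm (cap (phi_ n) \- v))).
      by rewrite ler_wpM2r ?sqnorm_ge0// lerDl.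
    by rewrite mulrC -ltr_pdivlMr// ltr_wpDl.
  by rewrite step_integral; exact: (cvg_unique _ conv2 conv1).
(* Since [w] is 0 outside [[a, b]], its primitive is 0 left of [a] and constant right of [b], so the
   segment decides all [y]. *)
have {}w0 y : \int[mu]_(s in `]-oo, y]) w s = 0.
  rewrite -Rintegral_itv_bndo_bndc; last exact: integrableS iw.
  have [ya|ay] := ltP y a.
    rewrite /Rintegral integral0_eq// => s /=; rewrite in_itv/= => sy.
    by rewrite /w patchE mem_setE in_itv/= leNgt (lt_trans sy ya).
  have [yb|by_] := leP y b; first by apply: w0; rewrite in_itv/= ay.
  transitivity (\int[mu]_(s in `]-oo, b[) w s); last first.
    by apply: w0; rewrite in_itv/= lexx (ltW ab).
  rewrite [RHS]Rintegral_itv_bndo_bndc; last exact: integrableS iw.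
  rewrite Rintegral_mkcond [RHS]Rintegral_mkcond; apply: eq_Rintegral => s _.
  rewrite /w !patchE !mem_setE !in_itv/=.
  case: (leP s b) => sb; last by rewrite andbF; case: ifP.
  by rewrite (le_lt_trans sb by_).
have := ae_eq0_of_primitive iw w0; apply: ae_imply => x + xab.
rewrite /w patchE mem_set// => /eqP; rewrite mulf_eq0 gt_eqF ?expR_gt0//=.
by move/eqP.
Unshelve. all: by end_near. Qed.

End closability.

(** * The closure of the Caputo derivative *)

Section L2_translation.
Context {R : realType}.
Local Notation mu := (@lebesgue_measure R).
Variables (a b : R).
Local Notation sqi := (sq_integrable mu `[a, b]).
Local Notation nrm := (sqnorm mu `[a, b]).

Lemma L2_integralE (f : R -> R) :
  (\int[mu]_x `|((f \_ `[a, b]) x)%:E| `^ 2 =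
   \int[mu]_(x in `[a, b]) (f x ^+ 2)%:E)%E.
Proof.
rewrite [RHS]integral_mkcond; apply: eq_integral => x _.
rewrite !patchE; case: ifPn => _.
  by rewrite abse_EFin poweR_EFin powR_mulrn// real_normK ?num_real.
by rewrite -[point]/(0 : R) abse_EFin normr0 poweR_EFin powR0.
Qed.

Lemma L2_normE (f : R -> R) : sqi f -> L2_norm a b f = (Num.sqrt (nrm f))%:E.
Proof.
move=> sf; rewrite /L2_norm unlock L2_integralE -EFin_sqnorm//.
by rewrite poweR_EFin powR12_sqrt// sqnorm_ge0.
Qed.

Lemma L2E (v : R -> R) : L2 a b v <-> sqi v.
Proof.
split=> [vL|[mv iv]].
  have iv := Lfun2_integrable_sqr vL.
  move: vL; rewrite /L2 inE => /andP[/[!inE]/= mv _].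
  split; first exact/measurable_restrictT.
  have /integrable_restrict : mu.-integrable setT
      ((fun x => (v x ^+ 2)%:E) \_ `[a, b]).
    apply: eq_integrable iv => // x _ /=; rewrite !patchE; case: ifP => // _.
    by rewrite -[point]/(0 : R) expr0n.
  by rewrite setTI; apply.
rewrite /L2 inE; apply/andP; rewrite !inE /=; split.
  exact: (measurable_restrictT _ _).1.
rewrite /finite_norm unlock L2_integralE.
have /integrableP[_ ] := iv => /(le_lt_trans _) h.
apply: poweR_lty; apply: h; apply: ge0_le_integral => //.
- by move=> x _; rewrite lee_fin sqr_ge0.
- by apply/measurable_EFinP; exact: measurable_funX.
- by apply: measurableT_comp => //; apply/measurable_EFinP; exact: measurable_funX.
- by move=> x _; exact: lee_abs.
Qed.

Lemma L2_cvgE (f : nat -> R -> R) (v : R -> R) :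
  (forall n, sqi (f n \- v)) ->
  L2_cvg a b f v <-> nrm (f n \- v) @[n --> \oo] --> 0.
Proof.
move=> sf; rewrite /L2_cvg.
rewrite (_ : (fun n => L2_norm a b (f n \- v)) =
   (fun n => (Num.sqrt (nrm (f n \- v)))%:E)); last first.
  by apply/funext => n; rewrite L2_normE.
split=> [/fine_cvgP[_ h]|h].
  rewrite (_ : (fun n => _) = fun n => Num.sqrt (nrm (f n \- v)) * Num.sqrt (nrm (f n \- v))).
    by rewrite -[0](mulr0 0); exact: cvgM.
  by apply/funext => n; rewrite -expr2 sqr_sqrtr// sqnorm_ge0.
apply: cvg_EFin; first exact: nearW.
rewrite -[0]sqrtr0.
by apply: (cvg_comp _ _ h); exact: sqrt_continuous.
Qed.

Lemma within_continuous_measurable (u : R -> R) :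
  {within `[a, b], continuous u} -> measurable_fun `[a, b] u.
Proof. by move=> cu; exact: subspace_continuous_measurable_fun. Qed.

Lemma within_continuous_bounded (u : R -> R) :
  {within `[a, b], continuous u} ->
  exists2 B, 0 <= B & forall x, x \in `[a, b] -> `|u x| <= B.
Proof.
move=> cu; have /compact_bounded[M [_ hM]] : compact (u @` `[a, b]).
  by apply: continuous_compact => //; exact: segment_compact.
exists (`|M| + 1) => [|x xab]; first by rewrite addr_ge0.
apply: (hM (`|M| + 1)); last by exists x.
by rewrite (le_lt_trans (ler_norm _))// ltrDl.
Qed.

Lemma sq_integrable_continuous (u : R -> R) : a < b ->
  {within `[a, b], continuous u} -> sqi u.
Proof.
move=> ab cu; have [B _ hB] := within_continuous_bounded cu.
exact: (sq_integrable_bounded ab (within_continuous_measurable cu) hB).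
Qed.

Lemma sqnorm_bounded (u : R -> R) (B : R) : a < b -> measurable_fun `[a, b] u ->
  0 <= B -> (forall x, x \in `[a, b] -> `|u x| <= B) -> nrm u <= B ^+ 2 * (b - a).
Proof.
move=> ab mu_ B0 hB; have [_ iu] := sq_integrable_bounded ab mu_ hB.
have -> : B ^+ 2 * (b - a) = \int[mu]_(x in `[a, b]) (cst (B ^+ 2) x).
  by rewrite Rintegral_cst//= ?lebesgue_measure_itv/= lte_fin ab.
apply: le_Rintegral => //.
  by apply: measurable_bounded_integrable => //;
    [rewrite /= lebesgue_measure_itv/= lte_fin ab -EFinD ltry|exact: bounded_cst].
move=> x xab; rewrite /cst -[leLHS]real_normK ?num_real//.
by rewrite lerXn2r ?nnegrE// hB.
Qed.

Lemma tempered_normE (alpha sigma e : R) (phi : R -> R) : 0 < e ->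
  sqi phi -> sqi (caputo a alpha sigma phi) ->
  (tempered_norm a b alpha sigma phi < e%:E)%E =
  (nrm phi + nrm (caputo a alpha sigma phi) < e ^+ 2).
Proof.
move=> e0 sp sc; rewrite /tempered_norm.
have sqE (f : R -> R) : sqi f ->
    (\int[mu]_(x in `[a, b]) (`|f x| ^+ 2)%:E = (nrm f)%:E)%E.
  move=> sf; rewrite EFin_sqnorm//; apply: eq_integral => x _.
  by rewrite real_normK ?num_real.
rewrite !sqE// -EFinD poweR_EFin powR12_sqrt ?addr_ge0 ?sqnorm_ge0//.
rewrite lte_fin -(@ltr_sqrt _ _ (e ^+ 2)) ?exprn_gt0//.
by rewrite sqrtr_sqr gtr0_norm.
Qed.

End L2_translation.

(** * Continuity and uniform convergence on a segment *)

Section continuous_on_segment.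
Context {R : realType}.
Local Notation mu := (@lebesgue_measure R).
Variables (a b : R).
Hypothesis ab : a < b.
Local Notation sqi := (sq_integrable mu `[a, b]).
Local Notation nrm := (sqnorm mu `[a, b]).

Lemma within_continuous_epsP (f : R -> R) : {within `[a, b], continuous f} <->
  (forall x e, x \in `[a, b] -> 0 < e -> exists2 d, 0 < d &
    forall y, y \in `[a, b] -> `|x - y| < d -> `|f x - f y| < e).
Proof.
split=> [/subspace_continuousP cf x e xab e0|H].
  have /cvgrPdist_lt/(_ e e0) := cf x xab.
  rewrite near_withinE => /nbhs_ballP[d /= d0 hd].
  by exists d => // y yab xy; exact: hd.
apply/subspace_continuousP => x xab; apply/cvgrPdist_lt => e e0.
have [d d0 hd] := H x e xab e0; rewrite near_withinE.
by apply/nbhs_ballP; exists d => //= y xy yab; exact: hd.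
Qed.

Definition ucvg (f : nat -> R -> R) (u : R -> R) :=
  forall e, 0 < e -> exists N, forall n, (N <= n)%N ->
    forall x, x \in `[a, b] -> `|f n x - u x| <= e.

Lemma ucvg_continuous (f : nat -> R -> R) (u : R -> R) :
  (forall n, {within `[a, b], continuous (f n)}) -> ucvg f u ->
  {within `[a, b], continuous u}.
Proof.
move=> cf fu; apply/within_continuous_epsP => x e xab e0.
have [N hN] := fu (e / 4) (divr_gt0 e0 (ltr0n _ 4)).
have /within_continuous_epsP/(_ x (e / 4) xab) := cf N.
rewrite divr_gt0// => /(_ isT)[d d0 hd]; exists d => // y yab xy.
have h1 := hN N (leqnn _) x xab; have h2 := hN N (leqnn _) y yab.
have h3 := hd y yab xy.
move: h1 h2 h3; rewrite !ler_norml !ltr_norml => /andP[? ?] /andP[? ?] /andP[? ?].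
by apply/andP; split; lra.
Qed.

Lemma ucvg_cauchy (f : nat -> R -> R) :
  (forall e, 0 < e -> exists N, forall m n, (N <= m)%N -> (N <= n)%N ->
    forall x, x \in `[a, b] -> `|f m x - f n x| <= e) ->
  exists u, ucvg f u.
Proof.
move=> cf; exists (fun x => limn (fun n => f n x)) => e e0.
have [N hN] := cf e e0; exists N => n Nn x xab.
have cx : cvgn (fun n => f n x).
  apply/cauchy_cvgP; apply: cauchy_exP => d d0.
  have [K hK] := cf (d / 2) (divr_gt0 d0 (ltr0n _ 2)).
  exists (f K x); exists K => // m /= Km.
  rewrite /ball/=; apply: le_lt_trans (hK _ _ (leqnn _) Km x xab) _.
  by rewrite ltr_pdivrMr// ltr_pMr// ltr1n.
have cd : (`|f n x - f k x|) @[k --> \oo] --> `|f n x - limn (fun n => f n x)|.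
  by apply: cvg_norm; apply: cvgB; [exact: cvg_cst|exact: cx].
rewrite -(cvg_lim _ cd)//; apply: limr_le; first exact: cvgP cd.
by exists N => // k /= Nk; exact: hN.
Qed.

Lemma ucvg_sqnorm (f : nat -> R -> R) (u : R -> R) :
  (forall n, measurable_fun `[a, b] (f n \- u)) -> ucvg f u ->
  nrm (f n \- u) @[n --> \oo] --> 0.
Proof.
move=> mf fu; apply/cvgrPdist_le => e e0.
pose d := Num.sqrt (e / (b - a)).
have ba0 : 0 < b - a by rewrite subr_gt0.
have d0 : 0 < d by rewrite sqrtr_gt0 divr_gt0.
have [N hN] := fu d d0; exists N => // n /= Nn.
rewrite sub0r normrN ger0_norm ?sqnorm_ge0//.
apply: (le_trans (sqnorm_bounded ab (mf n) (ltW d0) (hN n Nn))).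
rewrite sqr_sqrtr; last by apply: divr_ge0; exact: ltW.
by rewrite divfK// gt_eqF.
Qed.

Lemma not_negligible_oo (c d : R) : c < d -> ~ mu.-negligible `]c, d[.
Proof.
move=> cd /(negligibleP mu (measurable_itv _)).
move=> h; have : lebesgue_measure (`]c, d[%classic : set R) = 0%E by exact: h.
by rewrite lebesgue_measure_itv/= lte_fin cd -EFinD => -[]; lra.
Qed.

Lemma continuous_ae_eq (u w : R -> R) : {within `[a, b], continuous u} ->
  {within `[a, b], continuous w} ->
  {ae mu, forall x, x \in `[a, b] -> u x = w x} ->
  forall x, x \in `[a, b] -> u x = w x.
Proof.
move=> cu cw aeq x xab; apply/eqP; apply: contrapT => /negP uw.
have e0 : 0 < `|u x - w x| / 2 by rewrite divr_gt0// normr_gt0 subr_eq0.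
have /within_continuous_epsP/(_ _ _ xab e0)[d1 d10 h1] := cu.
have /within_continuous_epsP/(_ _ _ xab e0)[d2 d20 h2] := cw.
have [d [d0 dd1 dd2]] : exists d, [/\ 0 < d, d <= d1 & d <= d2].
  by exists (Num.min d1 d2); rewrite lt_min d10 !ge_min !lexx orbT.
move: (xab); rewrite in_itv/= => /andP[ax xb].
(* If the functions differ at [x] they differ on this whole interval. Clipping it to [[a, b]] leaves
   positive length even when [x] is an endpoint. *)
have lo : Num.max a (x - d) < Num.min b (x + d).
  by rewrite gt_max !lt_min ab /=; apply/and3P; split; lra.
apply: (not_negligible_oo lo); apply: negligibleS aeq => y /=.
rewrite in_itv/= gt_max lt_min => /andP[/andP[ay xy] /andP[yb yx]].
have yab : y \in `[a, b] by rewrite in_itv/= !ltW.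
move=> H; have {}H := H yab.
have xyd : `|x - y| < d by rewrite ltr_norml; apply/andP; split; lra.
have := h1 y yab (lt_le_trans xyd dd1); have := h2 y yab (lt_le_trans xyd dd2).
rewrite H; set z := w y => k2 k1.
have : `|u x - w x| <= `|u x - z| + `|w x - z|.
  by rewrite -[`|w x - z|]normrN -[X in `|X| <= _](_ : (u x - z) + - (w x - z) = _) ?ler_normD//; ring.
lra.
Qed.

Lemma sqnorm_eq0_ae (f : R -> R) : sqi f -> nrm f = 0 ->
  {ae mu, forall x, x \in `[a, b] -> f x = 0}.
Proof.
move=> sf nf0; have [mf _] := sf.
have := @EFin_sqnorm _ _ R mu _ (measurable_itv _) _ sf; rewrite nf0 => /esym h.
have mf2 : measurable_fun `[a, b] (fun x => (f x ^+ 2)%:E).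
  by apply/measurable_EFinP; exact: measurable_funX.
have [+ _] := ae_eq_integral_abs mu (measurable_itv `[a, b]) mf2.
under eq_integral do rewrite gee0_abs ?lee_fin ?sqr_ge0//.
move=> /(_ h); apply: ae_imply => x + xab => /(_ xab)/= [/eqP].
by rewrite expf_eq0/= => /eqP.
Qed.

Lemma sqnorm0_continuous_eq (u w : R -> R) : {within `[a, b], continuous u} ->
  {within `[a, b], continuous w} -> nrm (u \- w) = 0 ->
  forall x, x \in `[a, b] -> u x = w x.
Proof.
move=> cu cw uw; apply: continuous_ae_eq => //.
have suw : sqi (u \- w).
  by apply: sq_integrableB => //; exact: sq_integrable_continuous.
have := sqnorm_eq0_ae suw uw; apply: ae_imply.
by move=> x /[apply] /= /eqP; rewrite subr_eq0 => /eqP.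
Qed.

End continuous_on_segment.

(** * The L^2 closure of the graph *)

Section graph.
Context {R : realType}.
Local Notation mu := (@lebesgue_measure R).
Variables (a b alpha sigma : R).
Hypotheses (ab : a < b) (al : 2^-1 < alpha < 1).
Local Notation sqi := (sq_integrable mu `[a, b]).
Local Notation nrm := (sqnorm mu `[a, b]).
Local Notation cap := (caputo a alpha sigma).
Local Notation test := (test_function a b).

Let mD : measurable (`[a, b]%classic : set (measurableTypeR R)).
Proof. exact: measurable_itv. Qed.

Lemma cvg0_epsP (f : nat -> R) : (forall n, 0 <= f n) ->
  (f n @[n --> \oo] --> 0) <->
  (forall e, 0 < e -> exists N, forall n, (N <= n)%N -> f n < e).
Proof.
move=> f0; split=> [/cvgrPdist_lt h e e0|h].
  have [N _ hN] := h e e0; exists N => n /hN /=.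
  by rewrite sub0r normrN ger0_norm.
apply/cvgrPdist_lt => e /h[N hN]; exists N => // n /= /hN.
by rewrite sub0r normrN ger0_norm.
Qed.

Lemma ler_norm_sqr (x e : R) : 0 <= e -> x ^+ 2 <= e ^+ 2 -> `|x| <= e.
Proof.
by move=> e0; rewrite -[x ^+ 2]real_normK ?num_real// ler_pXn2r ?nnegrE.
Qed.

Definition sqcvg (f : nat -> R -> R) (v : R -> R) := forall e, 0 < e ->
  exists N, forall n, (N <= n)%N -> nrm (f n \- v) < e.

Lemma sqcvgP (f : nat -> R -> R) (v : R -> R) :
  nrm (f n \- v) @[n --> \oo] --> 0 <-> sqcvg f v.
Proof. by apply: cvg0_epsP => n; exact: sqnorm_ge0. Qed.

Definition sqcauchy (f : nat -> R -> R) := forall e, 0 < e ->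
  exists N, forall m n, (N <= m)%N -> (N <= n)%N -> nrm (f m \- f n) < e.

Lemma sqnormC (f g : R -> R) : nrm (f \- g) = nrm (g \- f).
Proof. by apply: eq_Rintegral => x _ /=; ring. Qed.

Lemma sqcvg_cauchy (f : nat -> R -> R) (v : R -> R) : (forall n, sqi (f n)) ->
  sqi v -> sqcvg f v -> sqcauchy f.
Proof.
move=> sf sv fv e e0; have [N hN] := fv (e / 4) (divr_gt0 e0 (ltr0n _ 4)).
exists N => m n Nm Nn.
apply: (le_lt_trans (sqnorm_triangle mD (sf m) sv (sf n))).
rewrite [nrm (v \- _)]sqnormC; have := hN m Nm; have := hN n Nn; lra.
Qed.

Lemma sqcvg_unique (f : nat -> R -> R) (u w : R -> R) : (forall n, sqi (f n)) ->
  sqi u -> sqi w -> sqcvg f u -> sqcvg f w -> nrm (u \- w) = 0.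
Proof.
move=> sf su sw fu fw; apply/eqP; rewrite eq_le sqnorm_ge0 andbT.
apply/ler_addgt0Pr => e e0; rewrite add0r.
have [N hN] := fu (e / 4) (divr_gt0 e0 (ltr0n _ 4)).
have [K hK] := fw (e / 4) (divr_gt0 e0 (ltr0n _ 4)).
pose n := maxn N K.
apply: (le_trans (sqnorm_triangle mD su (sf n) sw)).
rewrite [nrm (u \- _)]sqnormC.
have := hN n (leq_maxl _ _); have := hK n (leq_maxr _ _); lra.
Qed.

(** The rate [1 / (n + 1)] is the one used in the diagonal argument for [graph_closed]. *)
Lemma sqcvg_trans (f g : nat -> R -> R) (v : R -> R) : (forall n, sqi (f n)) ->
  (forall n, sqi (g n)) -> sqi v -> sqcvg g v ->
  (forall n, nrm (f n \- g n) < n.+1%:R^-1) -> sqcvg f v.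
Proof.
move=> sf sg sv gv fg e e0.
have [N hN] := gv (e / 4) (divr_gt0 e0 (ltr0n _ 4)).
have [K hK] := ltr_add_invr (divr_gt0 e0 (ltr0n _ 4)).
exists (maxn N K) => n; rewrite geq_max => /andP[Nn Kn].
apply: (le_lt_trans (sqnorm_triangle mD (sf n) (sg n) sv)).
have h1 := hN n Nn.
have h2 : nrm (f n \- g n) < e / 4.
  apply: (lt_trans (fg n)); apply: le_lt_trans hK; rewrite add0r.
  by rewrite lef_pV2 ?posrE ?ltr0n// ler_nat.
lra.
Qed.

(* [graph u v] says that [(u, v)] lies in the L^2-closure of the graph of the
   Caputo derivative on test functions, with [u] its continuous representative. *)
Definition is_graph (phi : nat -> R -> R) (u v : R -> R) :=
  [/\ forall n, test (phi n), sqcvg phi u &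
      sqcvg (fun n => cap (phi n)) v].

Definition graph (u v : R -> R) :=
  [/\ {within `[a, b], continuous u}, sqi v & exists phi, is_graph phi u v].

Lemma test_within phi : test phi -> {within `[a, b], continuous phi}.
Proof. by move=> tphi; exact/continuous_subspaceT/(test_continuous tphi). Qed.

Lemma sq_test phi : test phi -> sqi phi.
Proof. by move=> tphi; exact/sq_integrable_continuous/test_within. Qed.

Lemma sq_cap phi : test phi -> sqi (cap phi).
Proof. exact: sq_integrable_caputo. Qed.

Lemma testB phi psi : test phi -> test psi -> test (phi \- psi).
Proof.
move=> tphi tpsi; have := test_function_lin 1 (-1) tphi tpsi.
by congr test; apply/funext => x /=; ring.
Qed.

Lemma capB phi psi x : test phi -> test psi -> x \in `[a, b] ->
  cap (phi \- psi) x = cap phi x - cap psi x.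
Proof.
move=> tphi tpsi xab.
have := caputo_lin sigma ab al 1 (-1) tphi tpsi xab.
rewrite mul1r mulN1r => <-; congr (cap _ x).
by apply/funext => y /=; ring.
Qed.

Lemma sqnorm_capB phi psi : test phi -> test psi ->
  nrm (cap (phi \- psi)) = nrm (cap phi \- cap psi).
Proof.
move=> tphi tpsi; apply: eq_sqnorm => x; rewrite inE => xab.
by rewrite capB.
Qed.

(** The sup bound, applied to differences of test functions, converts L^2 control of derivatives
    into uniform control of the functions. *)
Lemma test_ucauchy (phi : nat -> R -> R) : (forall n, test (phi n)) ->
  sqcauchy (fun n => cap (phi n)) ->
  forall e, 0 < e -> exists N, forall m n, (N <= m)%N -> (N <= n)%N ->
    forall x, x \in `[a, b] -> `|phi m x - phi n x| <= e.
Proof.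
move=> tphi cphi e e0; have [M M0 hM] := test_sup_bound sigma ab al.
have d0 : 0 < e ^+ 2 / (M + 1) by rewrite divr_gt0 ?exprn_gt0// ltr_wpDl.
have [N hN] := cphi _ d0; exists N => m n Nm Nn x xab.
have := hM _ x (testB (tphi m) (tphi n)) xab; rewrite sqnorm_capB//= => h.
have h2 := hN m n Nm Nn.
apply: ler_norm_sqr; first exact: ltW.
apply: (le_trans h); apply: (@le_trans _ _ ((M + 1) * (e ^+ 2 / (M + 1)))).
  by apply: ler_pM => //; [exact: sqnorm_ge0|rewrite lerDl|exact: ltW].
have M1 : M + 1 != 0 by rewrite gt_eqF// ltr_wpDl.
by rewrite mulrC divfK.
Qed.

Lemma test_ucvg (phi : nat -> R -> R) : (forall n, test (phi n)) ->
  sqcauchy (fun n => cap (phi n)) ->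
  exists u, {within `[a, b], continuous u} /\ ucvg a b phi u.
Proof.
move=> tphi cphi; have [u hu] := ucvg_cauchy (test_ucauchy tphi cphi).
by exists u; split => //; apply: ucvg_continuous hu => n; exact: test_within.
Qed.

Lemma ucvg_test_sqnorm (phi : nat -> R -> R) u : (forall n, test (phi n)) ->
  {within `[a, b], continuous u} -> ucvg a b phi u ->
  nrm (phi n \- u) @[n --> \oo] --> 0.
Proof.
move=> tphi cu; apply: ucvg_sqnorm => // n; apply: measurable_funB.
  exact: within_continuous_measurable (test_within (tphi n)).
exact: within_continuous_measurable cu.
Qed.

(** The derivatives converge, so the functions have a continuous uniform limit. It agrees with the
    L^2 limit [u] almost everywhere, hence at every point of the segment by continuity. *)
Lemma is_graph_ucvg phi u v : {within `[a, b], continuous u} -> sqi v ->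
  is_graph phi u v -> ucvg a b phi u.
Proof.
move=> cu sv [tphi pu pv].
have sc n : sqi (cap (phi n)) by exact: sq_cap.
have [w [cw pw]] := test_ucvg tphi (sqcvg_cauchy sc sv pv).
have pw2 := (sqcvgP _ _).1 (ucvg_test_sqnorm tphi cw pw).
have st n : sqi (phi n) by exact: sq_test.
have su := sq_integrable_continuous ab cu.
have sw := sq_integrable_continuous ab cw.
have uw := sqnorm0_continuous_eq ab cu cw (sqcvg_unique st su sw pu pw2).
move=> e e0; have [N hN] := pw e e0; exists N => n Nn x xab.
by rewrite uw// hN.
Qed.

Lemma graph_ucvg_intro phi u v : (forall n, test (phi n)) ->
  {within `[a, b], continuous u} -> ucvg a b phi u -> sqi v ->
  sqcvg (fun n => cap (phi n)) v -> graph u v.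
Proof.
move=> tphi cu pu sv pv; split => //; exists phi; split => //.
by apply/sqcvgP; exact: ucvg_test_sqnorm.
Qed.

Lemma graph_ucvg u v : graph u v -> exists phi,
  [/\ forall n, test (phi n), ucvg a b phi u & sqcvg (fun n => cap (phi n)) v].
Proof.
move=> [cu sv [phi g]]; exists phi; have pu := is_graph_ucvg cu sv g.
by case: g.
Qed.

Lemma graph0 : graph (fun=> 0) (fun=> 0).
Proof.
have z : {within `[a, b], continuous (fun=> 0 : R)}.
  by apply: continuous_subspaceT => x; exact: cst_continuous.
have c0 x : x \in `[a, b] -> cap (fun=> 0) x = 0.
  move=> xab; have := capB (test_function0 a b) (test_function0 a b) xab.
  have -> : (fun=> 0 : R) \- (fun=> 0 : R) = (fun=> 0) :> (R -> R).
    by apply/funext => y /=; rewrite subr0.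
  by rewrite subrr.
apply: (@graph_ucvg_intro (fun _ _ => 0)) => //.
- by move=> _; exact: test_function0.
- by move=> e e0; exists 0%N => n _ x _; rewrite subrr normr0 ltW.
- exact: (sq_integrable_continuous ab z).
- move=> e e0; exists 0%N => n _.
  rewrite (@eq_sqnorm _ _ R mu `[a, b]%classic _ (fun=> 0)); last first.
    by move=> x; rewrite inE => xab /=; rewrite c0// subr0.
  rewrite /sqnorm; under eq_Rintegral do rewrite expr0n /=.
  by rewrite Rintegral_cst//= mul0r.
Qed.

Lemma graph_lin u1 v1 u2 v2 (k l : R) : graph u1 v1 -> graph u2 v2 ->
  graph (fun x => k * u1 x + l * u2 x) (fun x => k * v1 x + l * v2 x).
Proof.
move=> g1 g2; have [p1 [t1 c1 d1]] := graph_ucvg g1.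
have [p2 [t2 c2 d2]] := graph_ucvg g2.
case: g1 => cu1 s1 _; case: g2 => cu2 s2 _.
have tl n : test (fun x => k * p1 n x + l * p2 n x) by exact: test_function_lin.
have N0 : 0 < `|k| + `|l| + 1 by rewrite ltr_wpDl// addr_ge0.
have uc : ucvg a b (fun n x => k * p1 n x + l * p2 n x) (fun x => k * u1 x + l * u2 x).
  move=> e e0; have e'0 : 0 < e / (`|k| + `|l| + 1) by rewrite divr_gt0.
  have [N hN] := c1 _ e'0; have [K hK] := c2 _ e'0.
  exists (maxn N K) => n; rewrite geq_max => /andP[Nn Kn] x xab.
  have -> : k * p1 n x + l * p2 n x - (k * u1 x + l * u2 x) =
    k * (p1 n x - u1 x) + l * (p2 n x - u2 x) by ring.
  apply: (le_trans (ler_normD _ _)); rewrite !normrM.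
  apply: (@le_trans _ _ (`|k| * (e / (`|k| + `|l| + 1)) + `|l| * (e / (`|k| + `|l| + 1)))).
    by apply: lerD; apply: ler_wpM2l => //; [exact: hN|exact: hK].
  rewrite -mulrDl mulrCA ler_piMr ?(ltW e0)// ler_pdivrMr// mul1r lerDl//.
apply: (graph_ucvg_intro tl) => //.
- apply: ucvg_continuous uc => n; exact: test_within.
- exact: sq_integrable_lin.
move=> e e0.
(* The factor 2 comes from [sqnormB_le]; the [+ 1] covers [k = l = 0]. *)
have M0 : 0 < 2 * (k ^+ 2 + l ^+ 2 + 1).
  by rewrite mulr_gt0// ltr_wpDl// addr_ge0 ?sqr_ge0.
have e'0 : 0 < e / (2 * (k ^+ 2 + l ^+ 2 + 1)) by rewrite divr_gt0.
have [N hN] := d1 _ e'0; have [K hK] := d2 _ e'0.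
exists (maxn N K) => n; rewrite geq_max => /andP[Nn Kn].
have sd1 : sqi (cap (p1 n) \- v1) by apply: sq_integrableB => //; exact: sq_cap.
have sd2 : sqi (cap (p2 n) \- v2) by apply: sq_integrableB => //; exact: sq_cap.
have sk (c : R) f : sqi f -> sqi (fun x => c * f x).
  move=> sf; have := sq_integrable_lin mD c 0 sf sf.
  by apply: eq_sq_integrable => // x _; rewrite mul0r addr0.
have nk (c : R) f : sqi f -> nrm (fun x => c * f x) = c ^+ 2 * nrm f.
  move=> sf; rewrite /sqnorm -RintegralZl//; last by case: sf.
  by apply: eq_Rintegral => x _; rewrite exprMn.
rewrite (@eq_sqnorm _ _ R mu `[a, b]%classic _ ((fun x => k * (cap (p1 n) \- v1) x) \-
  (fun x => (- l) * (cap (p2 n) \- v2) x))); last first.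
  move=> x; rewrite inE => xab /=; rewrite (caputo_lin sigma ab al k l (t1 n) (t2 n) xab).
  by move: (cap (p1 n) x) (cap (p2 n) x) => ? ?; ring.
apply: (le_lt_trans (sqnormB_le mD (sk _ _ sd1) (sk _ _ sd2))).
rewrite !nk// sqrrN.
have h1 := hN n Nn; have h2 := hK n Kn.
set E := e / _ in h1 h2.
have EE : e = 2 * (k ^+ 2 + l ^+ 2 + 1) * E.
  by rewrite /E mulrC divfK// gt_eqF.
have E0 : 0 < E by [].
rewrite [ltRHS]EE.
have := ler_wpM2l (sqr_ge0 k) (ltW h1); have := ler_wpM2l (sqr_ge0 l) (ltW h2).
lra.
Qed.

(** Differences of two approximating sequences tend to 0 uniformly while their derivatives tend to
    [v \- v'] in L^2, so closability applies. *)
Lemma graph_unique u v v' : graph u v -> graph u v' ->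
  {ae mu, forall x, x \in `[a, b] -> v x = v' x}.
Proof.
move=> g1 g2; have [p1 [t1 c1 d1]] := graph_ucvg g1.
have [p2 [t2 c2 d2]] := graph_ucvg g2.
case: g1 => cu s1 _; case: g2 => _ s2 _.
have := @caputo_closable R a b alpha sigma ab al (fun n => p1 n \- p2 n) (v \- v').
have tB n : test (p1 n \- p2 n) by exact: testB.
move=> /(_ tB (sq_integrableB mD s1 s2)) H.
suff : {ae mu, forall x, x \in `[a, b] -> (v \- v') x = 0}.
  by apply: ae_imply => x + xab => /(_ xab)/eqP; rewrite /= subr_eq0 => /eqP.
apply: H.
- move=> e e0; have e20 : 0 < e / 2 by rewrite divr_gt0.
  have [N hN] := c1 _ e20; have [K hK] := c2 _ e20.
  exists (maxn N K) => n; rewrite geq_max => /andP[Nn Kn] x xab.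
  have := hN n Nn x xab; have := hK n Kn x xab; rewrite /= !ler_norml.
  by move=> /andP[? ?] /andP[? ?]; apply/andP; split; lra.
- apply/sqcvgP => e e0; have e40 : 0 < e / 4 by rewrite divr_gt0.
  have [N hN] := d1 _ e40; have [K hK] := d2 _ e40.
  exists (maxn N K) => n; rewrite geq_max => /andP[Nn Kn].
  have sd1 : sqi (cap (p1 n) \- v) by apply: sq_integrableB => //; exact: sq_cap.
  have sd2 : sqi (cap (p2 n) \- v') by apply: sq_integrableB => //; exact: sq_cap.
  rewrite (@eq_sqnorm _ _ R mu `[a, b]%classic _ ((cap (p1 n) \- v) \- (cap (p2 n) \- v'))); last first.
    move=> x; rewrite inE => xab /=; rewrite capB//=.
    by move: (cap (p1 n) x) (cap (p2 n) x) => ? ?; ring.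
  apply: (le_lt_trans (sqnormB_le mD sd1 sd2)).
  have := hN n Nn; have := hK n Kn; lra.
Qed.

Lemma graph_sup_bound : exists2 M, 0 <= M &
  forall u v, graph u v -> forall x, x \in `[a, b] -> u x ^+ 2 <= M * nrm v.
Proof.
have [M M0 hM] := test_sup_bound sigma ab al.
(* Passing from test functions to limits costs a factor 2 twice: once for the square of [u x], once
   for the squared norm of the derivative. *)
exists (2 * (2 * M)) => [|u v g x xab]; first by rewrite !mulr_ge0.
have [p [t c d]] := graph_ucvg g; case: g => cu sv _.
apply/ler_addgt0Pr => e e0.
(* The two tolerances each contribute at most [e / 2] to the final bound; the minimum with 1 below
   makes the square of the uniform error at most [e / 4]. *)
have e10 : 0 < e / (4 * (2 * M + 1)).
  by rewrite divr_gt0// mulr_gt0// ltr_wpDl// mulr_ge0.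
have e20 : 0 < Num.min 1 (e / 4) by rewrite lt_min ltr01 divr_gt0.
have [N hN] := d _ e10; have [K hK] := c _ e20.
pose n := maxn N K.
have h1 := hN n (leq_maxl _ _); have h2 := hK n (leq_maxr _ _) x xab.
have h3 := hM (p n) x (t n) xab.
have h4 : nrm (cap (p n)) <= 2 * nrm (cap (p n) \- v) + 2 * nrm v.
  rewrite [leLHS](@eq_sqnorm _ _ R mu `[a, b]%classic _ ((cap (p n) \- v) \- (fun x => (-1) * v x))); last first.
    by move=> y _ /=; move: (cap (p n) y) => ?; ring.
  have sm : sqi (fun x => (-1) * v x).
    have := sq_integrable_lin mD (-1) 0 sv sv.
    by apply: eq_sq_integrable => // y _; rewrite mul0r addr0.
  have sd : sqi (cap (p n) \- v) by apply: sq_integrableB => //; exact: sq_cap.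
  apply: (le_trans (sqnormB_le mD sd sm)).
  by rewrite (_ : nrm (fun x => -1 * v x) = nrm v)//; apply: eq_Rintegral => y _; ring.
have h5 : M * nrm (cap (p n)) <= M * (2 * nrm (cap (p n) \- v) + 2 * nrm v).
  by rewrite ler_wpM2l.
have h6 : u x ^+ 2 <= 2 * (p n x) ^+ 2 + 2 * (p n x - u x) ^+ 2.
  by have := sqr_ge0 (2 * p n x - u x); nra.
have h7 : (p n x - u x) ^+ 2 <= e / 4.
  move: h2; rewrite le_min => /andP[q1 q2].
  rewrite -[leLHS]real_normK ?num_real// expr2.
  by apply: le_trans q2; rewrite ler_piMl.
have h8 : M * nrm (cap (p n) \- v) <= e / 8.
  apply: (@le_trans _ _ (M * (e / (4 * (2 * M + 1))))).
    by rewrite ler_wpM2l// ltW.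
  have q0 : 0 < 4 * (2 * M + 1) by rewrite mulr_gt0// ltr_wpDl// mulr_ge0.
  by rewrite mulrA ler_pdivrMr//; nra.
lra.
Qed.

End graph.

(** * The tempered space as the domain of the closure *)

Section Hspace_graph.
Context {R : realType}.
Local Notation mu := (@lebesgue_measure R).
Variables (a b alpha sigma : R).
Hypotheses (ab : a < b) (al : 2^-1 < alpha < 1).
Local Notation sqi := (sq_integrable mu `[a, b]).
Local Notation nrm := (sqnorm mu `[a, b]).
Local Notation cap := (caputo a alpha sigma).
Local Notation test := (test_function a b).
Local Notation graph := (graph a b alpha sigma).
Local Notation sqcvg := (sqcvg a b).
Local Notation sqcauchy := (sqcauchy a b).

Let mD : measurable (`[a, b]%classic : set (measurableTypeR R)).
Proof. exact: measurable_itv. Qed.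

Let muD : (mu (`[a, b]%classic : set (measurableTypeR R)) < +oo)%E.
Proof. by rewrite /= lebesgue_measure_itv/= lte_fin ab -EFinD ltry. Qed.

Lemma ae_eq_sqnorm (f g : R -> R) : sqi f -> sqi g ->
  {ae mu, forall x, x \in `[a, b] -> f x = g x} -> nrm f = nrm g.
Proof.
move=> [mf _] [mg _] fg; rewrite /sqnorm /Rintegral; congr fine.
apply: ae_eq_integral => //.
- by apply/measurable_EFinP; exact: measurable_funX.
- by apply/measurable_EFinP; exact: measurable_funX.
- by apply: ae_imply fg => x h xab; rewrite h.
Qed.

Lemma sqcomplete (f : nat -> R -> R) : (forall n, sqi (f n)) -> sqcauchy f ->
  exists v (s : nat -> nat), [/\ sqi v, (forall k, (k <= s k)%N), sqcvg f v &
    {ae mu, forall x, x \in `[a, b] -> f (s k) x @[k --> \oo] --> v x}].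
Proof.
move=> sf cf; have [v [s [sv hs fv fae]]] := L2_complete mD muD sf cf.
by exists v, s; split => //; exact/sqcvgP.
Qed.

(** A diagonal argument: each pair is replaced by a test function at distance [1 / (n + 1)],
    uniformly in the function and in squared norm in the derivative. The limit of these test
    functions is again in the closure. *)
Lemma graph_closed (u_ v_ : nat -> R -> R) : (forall n, graph (u_ n) (v_ n)) ->
  sqcauchy v_ -> exists u v (s : nat -> nat), [/\ graph u v, ucvg a b u_ u,
    (forall k, (k <= s k)%N) &
    {ae mu, forall x, x \in `[a, b] -> v_ (s k) x @[k --> \oo] --> v x}].
Proof.
move=> g cv.
have sv_ n : sqi (v_ n) by case: (g n).
have [v [s [sv hs vv vae]]] := sqcomplete sv_ cv.
have /choice[phi hphi] : forall n, exists p, [/\ test p,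
    nrm (cap p \- v_ n) < n.+1%:R^-1 &
    forall x, x \in `[a, b] -> `|p x - u_ n x| <= n.+1%:R^-1].
  move=> n; have [p [tp up vp]] := graph_ucvg ab al (g n).
  have n0 : 0 < n.+1%:R^-1 :> R by rewrite invr_gt0 ltr0n.
  have [N hN] := up _ n0; have [K hK] := vp _ n0.
  exists (p (maxn N K)); split => //; first by apply: hK; exact: leq_maxr.
  by apply: hN; exact: leq_maxl.
have tphi n : test (phi n) by case: (hphi n).
have sc n : sqi (cap (phi n)) by apply: sq_cap.
have pv : sqcvg (fun n => cap (phi n)) v.
  by apply: (sqcvg_trans sc sv_ sv vv) => n; case: (hphi n).
have [u [cu pu]] := test_ucvg ab al tphi (sqcvg_cauchy sc sv pv).
exists u, v, s; split => //; first exact: graph_ucvg_intro pv.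
move=> e e0; have e20 : 0 < e / 2 by rewrite divr_gt0.
have [N hN] := pu _ e20; have [K] := ltr_add_invr e20; rewrite add0r => hK.
exists (maxn N K) => n; rewrite geq_max => /andP[Nn Kn] x xab.
have [_ _ /(_ x xab) h1] := hphi n.
have h2 := hN n Nn x xab.
have h3 : n.+1%:R^-1 <= e / 2.
  by apply: le_trans (ltW hK); rewrite lef_pV2 ?posrE ?ltr0n// ler_nat.
have := le_trans h1 h3; move: h2; rewrite !ler_norml => /andP[? ?] /andP[? ?].
by apply/andP; split; lra.
Qed.

Lemma approximatesP (phi : nat -> R -> R) u : {within `[a, b], continuous u} ->
  approximates a b alpha sigma phi u <->
  [/\ forall n, test (phi n), sqcauchy (fun n => cap (phi n)) & sqcvg phi u].
Proof.
move=> cu; have su := sq_integrable_continuous ab cu.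
have tnE (phi' : nat -> R -> R) m n e : (forall n, test (phi' n)) -> 0 < e ->
    (tempered_norm a b alpha sigma (phi' m \- phi' n)%R < e%:E)%E =
    (nrm (phi' m \- phi' n) + nrm (cap (phi' m) \- cap (phi' n)) < e ^+ 2).
  move=> t e0; have tB : test (phi' m \- phi' n) by exact: testB.
  by rewrite tempered_normE ?sqnorm_capB//; [exact: sq_test|exact: sq_cap].
split=> [[tphi cphi pu]|[tphi cphi pu]].
  have st n : sqi (phi n \- u).
    by apply: sq_integrableB => //; exact: sq_test.
  split => //; last by apply/sqcvgP; exact/L2_cvgE.
  move=> e e0; have [|N hN] := cphi (Num.sqrt e); first by rewrite sqrtr_gt0.
  exists N => m n Nm Nn; have := hN m n Nm Nn.
  rewrite tnE ?sqrtr_gt0// sqr_sqrtr ?ltW//.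
  by have := sqnorm_ge0 mu `[a, b] (phi m \- phi n); lra.
have st n : sqi (phi n) by exact: sq_test.
have stu n : sqi (phi n \- u) by exact: sq_integrableB.
split => //; last by apply/L2_cvgE => //; exact/sqcvgP.
move=> e e0; have e20 : 0 < e ^+ 2 / 2 by rewrite divr_gt0 ?exprn_gt0.
have [N hN] := cphi _ e20; have [K hK] := sqcvg_cauchy st su pu e20.
exists (maxn N K) => m n; rewrite !geq_max => /andP[Nm Km] /andP[Nn Kn].
rewrite tnE//; have := hN m n Nm Nn; have := hK m n Km Kn; lra.
Qed.

Lemma Hspace_of_graph u v : graph u v -> Hspace a b alpha sigma u.
Proof.
move=> g; have [cu sv [phi [tphi pu pv]]] := g; split => //; exists phi.
apply/approximatesP => //; split => //.
by apply: sqcvg_cauchy pv => // n; exact: sq_cap.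
Qed.

Lemma graph_caputoH u : Hspace a b alpha sigma u ->
  graph u (caputoH a b alpha sigma u).
Proof.
move=> [cu [phi ap]].
have lim psi : approximates a b alpha sigma psi u ->
    exists v, [/\ graph u v & sqcvg (fun n => cap (psi n)) v].
  move=> /(approximatesP _ cu)[tpsi cpsi pu].
  have sc n : sqi (cap (psi n)) by exact: sq_cap.
  have [v [_ [sv _ vv _]]] := sqcomplete sc cpsi.
  by exists v; split => //; split => //; exists psi.
have cvgE psi v : approximates a b alpha sigma psi u -> sqi v ->
    L2_cvg a b (fun n => cap (psi n)) v <-> sqcvg (fun n => cap (psi n)) v.
  move=> /(approximatesP _ cu)[tpsi _ _] sv.
  have sc n : sqi (cap (psi n) \- v).
    by apply: sq_integrableB => //; exact: sq_cap.
  by rewrite L2_cvgE// sqcvgP.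
have [v [gv pv]] := lim phi ap.
have [_ sv _] := gv.
(* Closability makes the limit along one approximating sequence valid along all of them. The set
   defining [caputoH] is therefore nonempty and [xget] does not fall back on its default. *)
have ex : exists w, [set v | L2 a b v /\
       forall psi, approximates a b alpha sigma psi u ->
         L2_cvg a b (fun n => cap (psi n)) v] w.
  exists v; split; first exact/L2E.
  move=> psi apsi; apply: (cvgE psi v apsi sv).2; have [v' [gv' pv']] := lim psi apsi.
  have [_ sv' _] := gv'.
  move/(approximatesP _ cu) : apsi => [tpsi _ _].
  move=> e /pv'[N hN]; exists N => n Nn.
  rewrite (@ae_eq_sqnorm _ (cap (psi n) \- v')); first exact: hN.
  - by apply: sq_integrableB => //; exact: sq_cap.
  - by apply: sq_integrableB => //; exact: sq_cap.
  - by apply: ae_imply (graph_unique ab al gv gv') => x h xab /=; rewrite h.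
have [/L2E sw hw] := xgetPex (fun=> 0) ex.
have pw := (cvgE phi _ ap sw).1 (hw phi ap).
move/(approximatesP _ cu) : ap => [tphi _ pu].
by split => //; exists phi.
Qed.

End Hspace_graph.

(** * The functional *)

Section composition.
Context {R : realType}.
Local Notation mu := (@lebesgue_measure R).

(* Replacing [v] by the grid values [floor (n v) / n] reduces the claim to
   countably many of the maps [G c]. *)
Lemma caratheodory_measurable d (T : measurableType d) (D : set T)
    (G : R -> T -> R) (v : T -> R) : measurable D ->
  (forall c, measurable_fun D (G c)) ->
  (forall t, D t -> continuous (fun c => G c t)) ->
  measurable_fun D v -> measurable_fun D (fun t => G (v t) t).
Proof.
move=> mD mG cG mv.
pose grid (n : nat) (y : R) : R := (Num.floor (n.+1%:R * y))%:~R / n.+1%:R.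
have gridE n y : `|y - grid n y| <= n.+1%:R^-1.
  have n0 : 0 < n.+1%:R :> R by rewrite ltr0n.
  have -> : y - grid n y = (n.+1%:R * y - (Num.floor (n.+1%:R * y))%:~R) / n.+1%:R.
    by rewrite /grid mulrBl mulrAC divff ?gt_eqF// mul1r.
  rewrite normrM (gtr0_norm (_ : 0 < n.+1%:R^-1)) ?invr_gt0//.
  have /andP[f1 f2] := floor_itv (n.+1%:R * y); rewrite intrD in f2.
  apply: ler_piMl; first by rewrite invr_ge0 ltW.
  by rewrite ger0_norm; lra.
have grid_cvg y : grid n y @[n --> \oo] --> y.
  apply/cvgrPdist_lt => e e0; have [N] := ltr_add_invr e0; rewrite add0r => hN.
  exists N => // n /= Nn; apply: le_lt_trans (gridE n y) (le_lt_trans _ hN).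
  by rewrite lef_pV2 ?posrE ?ltr0n// ler_nat.
apply: (@measurable_fun_cvg _ _ _ _ (fun n t => G (grid n (v t)) t)); last first.
  move=> t Dt; exact: (cvg_comp _ _ (grid_cvg (v t)) (cG t Dt (v t))).
move=> n _ Y mY.
rewrite (_ : D `&` _ = \bigcup_(k : int)
   ((D `&` [set t | Num.floor (n.+1%:R * v t) = k]) `&`
    (D `&` (G (k%:~R / n.+1%:R)) @^-1` Y))); last first.
  apply/seteqP; split => [t [Dt Yt]|t [k _ [[Dt /= <-] [_ Yt]]]] //.
  by exists (Num.floor (n.+1%:R * v t)).
apply: countable_bigcupT_measurable => // k; apply: measurableI; last exact: mG.
have mnv : measurable_fun D (fun t => n.+1%:R * v t) by exact: measurable_funM.
have -> : D `&` [set t | Num.floor (n.+1%:R * v t) = k] =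
    D `&` (fun t => n.+1%:R * v t) @^-1` `[k%:~R, (k + 1)%:~R[.
  apply/seteqP; split => t /= [Dt].
    by move=> <-; split => //; rewrite in_itv/= floor_itv.
  by rewrite in_itv/= => h; split => //; exact: floor_def.
exact: mnv.
Qed.

Variables (a b : R).

Lemma within_continuous_comp3 (f : R -> R -> R -> R) (u v : R -> R) :
  continuous_strip3 a b f -> {within `[a, b], continuous u} ->
  {within `[a, b], continuous v} ->
  {within `[a, b], continuous (fun t => f (u t) (v t) t)}.
Proof.
move=> /subspace_continuousP cf /subspace_continuousP cu /subspace_continuousP cv.
apply/subspace_continuousP => t tab.
have h : (u s, v s, s) @[s --> within `[a, b]%classic (nbhs t)] -->
    within [set p : R * R * R | p.2 \in `[a, b]] (nbhs (u t, v t, t)).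
  have h0 : (u s, v s, s) @[s --> within `[a, b]%classic (nbhs t)] --> (u t, v t, t).
    have huv : (u s, v s) @[s --> within `[a, b]%classic (nbhs t)] --> (u t, v t).
      exact: (@cvg_pair _ _ _ _ (nbhs (u t)) (nbhs (v t)) _ _ _ u v (cu t tab) (cv t tab)).
    have hs : s @[s --> within `[a, b]%classic (nbhs t)] --> t.
      exact: cvg_within.
    exact: (@cvg_pair _ _ _ _ (nbhs (u t, v t)) (nbhs t) _ _ _ (fun s => (u s, v s)) id huv hs).
  move=> A wA; have := h0 _ wA; rewrite /nbhs/= /within/=.
  by apply: filterS => s hs sab; exact: hs.
exact: (cvg_comp _ _ h (cf (u t, v t, t) tab)).
Qed.

Lemma within_continuous_comp2 (f : R -> R -> R) (u : R -> R) :
  continuous_strip2 a b f -> {within `[a, b], continuous u} ->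
  {within `[a, b], continuous (fun t => f (u t) t)}.
Proof.
move=> /subspace_continuousP cf /subspace_continuousP cu.
apply/subspace_continuousP => t tab.
have h : (u s, s) @[s --> within `[a, b]%classic (nbhs t)] -->
    within [set p : R * R | p.2 \in `[a, b]] (nbhs (u t, t)).
  have h0 : (u s, s) @[s --> within `[a, b]%classic (nbhs t)] --> (u t, t).
    have hs : s @[s --> within `[a, b]%classic (nbhs t)] --> t.
      exact: cvg_within.
    exact: (@cvg_pair _ _ _ _ (nbhs (u t)) (nbhs t) _ _ _ u id (cu t tab) hs).
  move=> A wA; have := h0 _ wA; rewrite /nbhs/= /within/=.
  by apply: filterS => s hs sab; exact: hs.
exact: (cvg_comp _ _ h (cf (u t, t) tab)).
Qed.

Lemma strip3_cvg (f : R -> R -> R -> R) (x_ y_ : nat -> R) (x y t : R) :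
  continuous_strip3 a b f -> t \in `[a, b] ->
  x_ n @[n --> \oo] --> x -> y_ n @[n --> \oo] --> y ->
  f (x_ n) (y_ n) t @[n --> \oo] --> f x y t.
Proof.
move=> /subspace_continuousP cf tab cx cy.
have h : (x_ n, y_ n, t) @[n --> \oo] -->
    within [set p : R * R * R | p.2 \in `[a, b]] (nbhs (x, y, t)).
  have h0 : (x_ n, y_ n, t) @[n --> \oo] --> (x, y, t).
    have cxy : (x_ n, y_ n) @[n --> \oo] --> (x, y).
      exact: (@cvg_pair _ _ _ _ (nbhs x) (nbhs y) _ _ _ x_ y_ cx cy).
    have ct : (fun=> t) n @[n --> \oo] --> t by exact: cvg_cst.
    exact: (@cvg_pair _ _ _ _ (nbhs (x, y)) (nbhs t) _ _ _ (fun n => (x_ n, y_ n)) (fun=> t) cxy ct).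
  move=> A wA; have := h0 _ wA; rewrite /nbhs/= /within/=.
  by apply: filterS => s hs; exact: hs.
exact: (cvg_comp _ _ h (cf (x, y, t) tab)).
Qed.

End composition.

(** * Comparison of powers with squares *)

Section power_bounds.
Context {R : realType}.

Lemma powR_le_sqr (d y : R) : 0 < d <= 2 -> 0 <= y -> y `^ d <= 1 + y ^+ 2.
Proof.
move=> /andP[d0 d2] y0; have [y1|y1] := leP y 1.
  apply: (@le_trans _ _ 1); last by rewrite lerDl sqr_ge0.
  have e1 : (1 : R) `^ d = 1 by rewrite powR1.
  by rewrite -[leRHS]e1; apply: ge0_ler_powR; rewrite ?nnegrE// ltW.
apply: (@le_trans _ _ (y ^+ 2)); last by rewrite lerDr.
by rewrite -powR_mulrn//; apply: ler_powR => //; exact: ltW.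
Qed.

Lemma powR_le_eps_sqr (d e : R) : 0 < d < 2 -> 0 < e ->
  exists2 A, 0 <= A & forall z, 0 <= z -> z `^ d <= e * z ^+ 2 + A.
Proof.
(* At the threshold [z0] the two sides [z^d] and [e * z^2] are equal; below it [z^d] is at most
   [z0^d], above it the square dominates. *)
move=> /andP[d0 d2] e0; pose z0 := (e^-1) `^ ((2 - d)^-1).
have z00 : 0 < z0 by rewrite powR_gt0// invr_gt0.
exists (z0 `^ d) => [|z zge0]; first exact: powR_ge0.
have [zz0|zz0] := leP z z0.
  apply: (@le_trans _ _ (z0 `^ d)); last by rewrite lerDr mulr_ge0 ?sqr_ge0 ?ltW.
  by apply: ge0_ler_powR => //; rewrite ?nnegrE// ltW.
have zgt0 : 0 < z by exact: lt_trans zz0.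
apply: (@le_trans _ _ (e * z ^+ 2)); last by rewrite lerDl powR_ge0.
have hz : e^-1 <= z `^ (2 - d).
  have -> : e^-1 = z0 `^ (2 - d).
    by rewrite /z0 -powRrM mulVf ?powRr1 ?invr_ge0 ?(ltW e0)// gt_eqF// subr_gt0.
  by apply: ge0_ler_powR; rewrite ?nnegrE ?subr_ge0 ?ltW.
have -> : z ^+ 2 = z `^ d * z `^ (2 - d).
  rewrite -powRD; last by rewrite (gt_eqF zgt0) implybT.
  by rewrite (_ : d + (2 - d) = 2%:R) ?powR_mulrn//; ring.
rewrite mulrCA ler_peMr ?powR_ge0// -ler_pdivrMl// mulr1.
exact: hz.
Qed.

End power_bounds.

(** * Integrability, coercivity and lower semicontinuity *)

Section functional.
Context {R : realType}.
Local Notation mu := (@lebesgue_measure R).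
Variables (a b alpha sigma : R) (L : R -> R -> R -> R)
    (d1 d4 zeta : R) (r1 s1 c1 : R -> R -> R) (c2 c3 : R -> R).
Hypotheses (ab : a < b) (al : 2^-1 < alpha < 1).
Hypothesis hL : C1_strip a b L.
Hypotheses (hd1 : 0 < d1 <= 2) (hr1 : continuous_strip2 a b r1)
  (hs1 : continuous_strip2 a b s1).
Hypothesis h1 : forall x y t, t \in `[a, b] ->
      `|L x y t - L x 0 t| <= r1 x t * `|y| `^ d1 + s1 x t.
Hypotheses (hzeta : 0 < zeta) (hd4 : 1 <= d4 < 2).
Hypothesis hc1zeta : forall x t, t \in `[a, b] -> zeta <= c1 x t.
Hypotheses (hc2 : {within `[a, b], continuous c2})
  (hc3 : {within `[a, b], continuous c3}).
Hypothesis h4 : forall x y t, t \in `[a, b] ->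
      c1 x t * `|y| ^+ 2 + c2 t * `|x| `^ d4 + c3 t <= L x y t.

Local Notation sqi := (sq_integrable mu `[a, b]).
Local Notation nrm := (sqnorm mu `[a, b]).
Local Notation graph := (graph a b alpha sigma).

Let mD : measurable (`[a, b]%classic : set (measurableTypeR R)).
Proof. exact: measurable_itv. Qed.

Let muD : (mu (`[a, b]%classic : set (measurableTypeR R)) < +oo)%E.
Proof. by rewrite /= lebesgue_measure_itv/= lte_fin ab -EFinD ltry. Qed.

(** The derivative is a separate argument, so that any representative can be used; [action_graph]
    identifies the value with [action]. *)
Definition pair_action (u v : R -> R) : R :=
  \int[mu]_(t in `[a, b]) L (u t) (v t) t.

Let cL : continuous_strip3 a b L. Proof. by case: hL. Qed.

Lemma integrand_measurable u v : {within `[a, b], continuous u} ->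
  measurable_fun `[a, b] v -> measurable_fun `[a, b] (fun t => L (u t) (v t) t).
Proof.
move=> cu mv.
apply: (@caratheodory_measurable R _ _ `[a, b] (fun c t => L (u t) c t) v) => //.
  move=> c; apply: within_continuous_measurable.
  apply: (within_continuous_comp3 cL cu).
  by apply: continuous_subspaceT => x; exact: cst_continuous.
move=> t tab c; apply: derivable_continuous.
by case: hL => _ /(_ (u t) c t tab)[].
Qed.

Lemma integrable_cst_seg (c : R) : mu.-integrable `[a, b] (fun=> c%:E).
Proof.
apply: (@measurable_bounded_integrable _ _ _ mu (cst c)) => //.
exact: bounded_cst.
Qed.

(** A continuous [u] is bounded on the segment, so the coefficients along [u] are bounded, and the
    growth in [v] is at most quadratic. *)
Lemma integrand_integrable u v : {within `[a, b], continuous u} -> sqi v ->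
  mu.-integrable `[a, b] (fun t => (L (u t) (v t) t)%:E).
Proof.
move=> cu [mv iv].
have c0 : {within `[a, b], continuous (fun=> 0 : R)}.
  by apply: continuous_subspaceT => x; exact: cst_continuous.
have [B0 B00 hB0] := within_continuous_bounded (within_continuous_comp3 cL cu c0).
have [B1 B10 hB1] := within_continuous_bounded (within_continuous_comp2 hr1 cu).
have [B2 B20 hB2] := within_continuous_bounded (within_continuous_comp2 hs1 cu).
apply: (@le_integrable _ _ R mu _ mD _
   (fun t => ((B0 + B1 + B2)%:E + B1%:E * (v t ^+ 2)%:E)%E)).
- by apply/measurable_EFinP; exact: integrand_measurable.
- move=> t tab; rewrite -EFinM -EFinD !abse_EFin lee_fin.
  rewrite [leRHS]ger0_norm; last first.
    by apply: addr_ge0; [rewrite !addr_ge0|rewrite mulr_ge0 ?sqr_ge0].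
  have -> : L (u t) (v t) t = L (u t) 0 t + (L (u t) (v t) t - L (u t) 0 t) by ring.
  apply: (le_trans (ler_normD _ _)).
  have q0 := hB0 t tab; have q1 := le_trans (ler_norm _) (hB1 t tab).
  have q2 := le_trans (ler_norm _) (hB2 t tab).
  have q3 := h1 (u t) (v t) tab.
  have q4 : r1 (u t) t * `|v t| `^ d1 <= B1 * (1 + v t ^+ 2).
    apply: (@le_trans _ _ (B1 * `|v t| `^ d1)).
      by rewrite ler_wpM2r ?powR_ge0.
    rewrite ler_wpM2l//; apply: le_trans (powR_le_sqr hd1 (normr_ge0 _)) _.
    by rewrite real_normK ?num_real.
  move: (L _ _ _) (L _ _ _) (r1 _ _ * _) (s1 _ _) (v t ^+ 2) q0 q2 q3 q4.
  by move=> *; lra.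
- by apply: integrableD => //; [exact: integrable_cst_seg|exact: integrableZl].
Qed.

Lemma graph_integrable u v : graph u v ->
  mu.-integrable `[a, b] (fun t => (L (u t) (v t) t)%:E).
Proof. by case=> cu sv _; exact: integrand_integrable. Qed.

Lemma ae_eq_pair_action u v v' : graph u v -> graph u v' ->
  pair_action u v = pair_action u v'.
Proof.
move=> g g'; have vv' := graph_unique ab al g g'.
case: g => cu [mv _] _; case: g' => _ [mv' _] _.
rewrite /pair_action /Rintegral; congr fine; apply: ae_eq_integral => //.
- by apply/measurable_EFinP; exact: integrand_measurable.
- by apply/measurable_EFinP; exact: integrand_measurable.
- by apply: ae_imply vv' => x h xab; rewrite h.
Qed.

Lemma action_graph u v : graph u v ->
  action a b alpha sigma L u = pair_action u v.
Proof.
move=> g; have g' := graph_caputoH ab al (Hspace_of_graph ab al g).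
exact: ae_eq_pair_action g' g.
Qed.

Let bounds : exists C2 C3, [/\ 0 <= C2, 0 <= C3 & forall x y t, t \in `[a, b] ->
  zeta * y ^+ 2 - C2 * `|x| `^ d4 - C3 <= L x y t].
Proof.
have [C2 C20 hC2] := within_continuous_bounded hc2.
have [C3 C30 hC3] := within_continuous_bounded hc3.
exists C2, C3; split => // x y t tab; apply: le_trans (h4 x y tab).
have q1 : zeta * y ^+ 2 <= c1 x t * `|y| ^+ 2.
  by rewrite real_normK ?num_real// ler_wpM2r ?sqr_ge0// hc1zeta.
have q2 : - C2 * `|x| `^ d4 <= c2 t * `|x| `^ d4.
  by rewrite ler_wpM2r ?powR_ge0//; have := hC2 t tab; rewrite ler_norml => /andP[].
have q3 : - C3 <= c3 t by have := hC3 t tab; rewrite ler_norml => /andP[].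
move: q1 q2; rewrite mulNr.
by move: (zeta * _) (c1 _ _ * _) (c2 _ * _) (C2 * _) => *; lra.
Qed.

Lemma integrable_sqr v : sqi v -> mu.-integrable `[a, b] (EFin \o (fun t => v t ^+ 2)).
Proof. by case. Qed.

Let coercive_alg (z n c e m k w : R) :
  z * n - (c * (e * (m * n)) + k) * w =
  z / 2 * n + (z / 2 * n - e * (c * m * w) * n) - k * w.
Proof. by field. Qed.

Lemma coercive : exists2 k, 0 < k & exists K, forall u v, graph u v ->
  k * nrm v - K <= pair_action u v.
Proof.
have [C2 [C3 [C20 C30 hb]]] := bounds.
have [M M0 hM] := graph_sup_bound sigma ab al.
have ba0 : 0 < b - a by rewrite subr_gt0.
pose N := C2 * M * (b - a).
have N0 : 0 <= N by rewrite !mulr_ge0// ltW.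
(* By the sup bound, the term with exponent [d4] costs at most [e * N * nrm v] plus a constant. This
   [e] keeps the cost below half of [zeta * nrm v]. *)
pose e := zeta / (2 * (N + 1)).
have N1 : 0 < N + 1 by rewrite ltr_wpDl.
have e0 : 0 < e by rewrite divr_gt0// mulr_gt0.
have d4' : 0 < d4 < 2 by case/andP: hd4 => ? ?; apply/andP; split; lra.
have [A A0 hA] := powR_le_eps_sqr d4' e0.
have eN : e * N <= zeta / 2.
  have -> : e * N = zeta / 2 * (N / (N + 1)) by rewrite /e; field; rewrite gt_eqF.
  rewrite ler_piMr ?divr_ge0 ?(ltW hzeta)//.
  by rewrite ler_pdivrMr// mul1r lerDl.
exists (zeta / 2); first by rewrite divr_gt0.
exists ((C2 * A + C3) * (b - a)) => u v g; have ig := graph_integrable g.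
have bu := hM _ _ g; case: g => cu sv _.
have nv := sqnorm_ge0 mu `[a, b] v.
pose K := C2 * (e * (M * nrm v)) + (C2 * A + C3).
have iz : mu.-integrable `[a, b] (EFin \o (fun t => zeta * v t ^+ 2)).
  have := integrableZl mD zeta (integrable_sqr sv).
  by apply: eq_integrable => // t _; rewrite /= EFinM.
have ik : mu.-integrable `[a, b] (EFin \o cst K) by exact: integrable_cst_seg.
have step : zeta * nrm v - K * (b - a) <= pair_action u v.
  have -> : zeta * nrm v - K * (b - a) =
      \int[mu]_(t in `[a, b]) (zeta * v t ^+ 2 - cst K t).
    rewrite RintegralB// RintegralZl//; last exact: integrable_sqr.
    by rewrite Rintegral_cst//= lebesgue_measure_itv/= lte_fin ab.
  apply: le_Rintegral => //.
    have := integrableB mD iz ik.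
    by apply: eq_integrable => // t _; rewrite /= EFinB.
  move=> t tab; apply: le_trans (hb (u t) (v t) t tab).
  have q1 : `|u t| `^ d4 <= e * (M * nrm v) + A.
    apply: (le_trans (hA _ (normr_ge0 _))); rewrite lerD2r ler_wpM2l ?(ltW e0)//.
    by rewrite real_normK ?num_real//; exact: bu.
  have := ler_wpM2l C20 q1; rewrite mulrDr => q2.
  by rewrite /K /cst -[leRHS]addrA -opprD lerD2l lerN2 addrA lerD2r.
apply: le_trans step; rewrite /K.
have : e * N * nrm v <= zeta / 2 * nrm v by rewrite ler_wpM2r.
rewrite coercive_alg -/N => h; rewrite lerD2r lerDl subr_ge0.
exact: h.
Qed.

Lemma pair_action_lsc (u_ v_ : nat -> R -> R) (u v : R -> R) (Q m : R) :
  (forall k, graph (u_ k) (v_ k)) -> (forall k, nrm (v_ k) <= Q) ->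
  graph u v -> (forall t, t \in `[a, b] -> u_ k t @[k --> \oo] --> u t) ->
  {ae mu, forall t, t \in `[a, b] -> v_ k t @[k --> \oo] --> v t} ->
  (forall e, 0 < e -> exists N, forall k, (N <= k)%N -> pair_action (u_ k) (v_ k) <= m + e) ->
  pair_action u v <= m.
Proof.
move=> g_ hQ g cu cv hm.
have [C2 [C3 [C20 C30 hb]]] := bounds.
have [M M0 hM] := graph_sup_bound sigma ab al.
have Q0 : 0 <= Q by apply: le_trans (hQ 0%N); exact: sqnorm_ge0.
(* Fatou's lemma needs nonnegative integrands. The bound [Q] on the derivatives bounds all [u_ k]
   uniformly, so one constant shift [B] serves every [k]; its integral cancels at the end. *)
pose B := C2 * (1 + M * Q) + C3.
have lowB k t : t \in `[a, b] -> 0 <= L (u_ k t) (v_ k t) t + B.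
  move=> tab; have q0 := hb (u_ k t) (v_ k t) t tab.
  have q1 : `|u_ k t| `^ d4 <= 1 + M * Q.
    have d4' : 0 < d4 <= 2 by case/andP: hd4 => ? ?; apply/andP; split; lra.
    apply: (le_trans (powR_le_sqr d4' (normr_ge0 _))); rewrite lerD2l.
    rewrite real_normK ?num_real//; apply: (le_trans (hM _ _ (g_ k) t tab)).
    by rewrite ler_wpM2l.
  have q2 : 0 <= zeta * v_ k t ^+ 2 by rewrite mulr_ge0 ?sqr_ge0 ?ltW.
  rewrite -lerBlDr sub0r; apply: le_trans q0; rewrite /B opprD lerD2r.
  by rewrite -[leLHS]add0r lerD// lerN2 ler_wpM2l.
pose f k t := (L (u_ k t) (v_ k t) t + B)%:E.
have mL u' v' : graph u' v' -> measurable_fun `[a, b] (fun t => L (u' t) (v' t) t).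
  by case=> ? [? _] _; exact: integrand_measurable.
have mf k : measurable_fun `[a, b] (f k).
  by apply/measurable_EFinP; apply: measurable_funD => //; exact: mL.
have f0 k t : `[a, b]%classic t -> (0 <= f k t)%E.
  by move=> tab; rewrite lee_fin; exact: lowB.
have iadd u' v' : graph u' v' ->
    (\int[mu]_(t in `[a, b]) (L (u' t) (v' t) t + B)%:E =
    (pair_action u' v' + B * (b - a))%:E)%E.
  move=> g'; have ig' := graph_integrable g'.
  under eq_integral do rewrite EFinD.
  rewrite integralD//; last exact: integrable_cst_seg.
  have -> : (\int[mu]_(t in `[a, b]) B%:E = (B * (b - a))%:E)%E.
    rewrite (eq_integral (cst B%:E))// integral_cst//.
    by rewrite [X in (_ * X)%E](_ : _ = (b - a)%:E)//= lebesgue_measure_itv/= lte_fin ab.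
  by rewrite -[X in (X + _)%E]fineK ?integrable_fin_num.
have fl : {ae mu, forall t, t \in `[a, b] -> limn_einf (f ^~ t) = (L (u t) (v t) t + B)%:E}.
  apply: ae_imply cv => t h tab.
  have c : f k t @[k --> \oo] --> (L (u t) (v t) t + B)%:E.
    apply: cvg_EFin; first exact: nearW.
    apply: (@cvgD _ _ _ _ _ (fun k => L (u_ k t) (v_ k t) t) (fun=> B)); last exact: cvg_cst.
    exact: strip3_cvg cL tab (cu t tab) (h tab).
  by rewrite (cvg_limn_einf_sup c).1.
have := fatou mu mD mf f0.
have -> : (\int[mu]_(t in `[a, b]) limn_einf (f ^~ t) =
    (pair_action u v + B * (b - a))%:E)%E.
  rewrite -iadd//; apply: ae_eq_integral => //.
  - exact: measurable_fun_limn_einf.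
  - by apply/measurable_EFinP; apply: measurable_funD => //; exact: mL.
move=> fat; apply/ler_addgt0Pr => e e0.
rewrite -(lerD2r (B * (b - a))) -lee_fin; apply: (le_trans fat).
have [N hN] := hm e e0.
rewrite limn_einf_lim; apply: lime_le; first exact: is_cvg_einfs.
apply: nearW => n; pose k := maxn n N.
apply: (@le_trans _ _ (\int[mu]_(t in `[a, b]) f k t)%E).
  by apply: ereal_inf_lbound; exists k => //=; exact: leq_maxl.
by rewrite /f iadd// lee_fin lerD2r hN// leq_maxr.
Qed.

End functional.

(** * Minimizers *)

Section direct_method.
Context {R : realType}.
Local Notation mu := (@lebesgue_measure R).
Variables (a b alpha sigma : R) (L : R -> R -> R -> R)
    (d1 d4 zeta : R) (r1 s1 c1 : R -> R -> R) (c2 c3 : R -> R).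
Hypotheses (ab : a < b) (al : 2^-1 < alpha < 1).
Hypothesis hL : C1_strip a b L.
Hypotheses (hd1 : 0 < d1 <= 2) (hr1 : continuous_strip2 a b r1)
  (hs1 : continuous_strip2 a b s1).
Hypothesis h1 : forall x y t, t \in `[a, b] ->
      `|L x y t - L x 0 t| <= r1 x t * `|y| `^ d1 + s1 x t.
Hypotheses (hzeta : 0 < zeta) (hd4 : 1 <= d4 < 2).
Hypothesis hc1zeta : forall x t, t \in `[a, b] -> zeta <= c1 x t.
Hypotheses (hc2 : {within `[a, b], continuous c2})
  (hc3 : {within `[a, b], continuous c3}).
Hypothesis h4 : forall x y t, t \in `[a, b] ->
      c1 x t * `|y| ^+ 2 + c2 t * `|x| `^ d4 + c3 t <= L x y t.
Hypothesis h5 : forall t, t \in `[a, b] ->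
      @convex_function R (R^o * R^o)%type setT
        (fun p : R^o * R^o => L p.1 p.2 t).

Local Notation sqi := (sq_integrable mu `[a, b]).
Local Notation nrm := (sqnorm mu `[a, b]).
Local Notation graph := (graph a b alpha sigma).
Local Notation Jp := (pair_action a b L).
Local Notation mid u v := (fun x => 2^-1 * u x + 2^-1 * v x).

Let mD : measurable (`[a, b]%classic : set (measurableTypeR R)).
Proof. exact: measurable_itv. Qed.

Let ig u v : graph u v -> mu.-integrable `[a, b] (EFin \o (fun t => L (u t) (v t) t)).
Proof. exact: (graph_integrable ab hL hd1 hr1 hs1 h1). Qed.

Lemma midpoint_convex x1 x2 y1 y2 t : t \in `[a, b] ->
  L (2^-1 * x1 + 2^-1 * x2) (2^-1 * y1 + 2^-1 * y2) t <=
  2^-1 * L x1 y1 t + 2^-1 * L x2 y2 t.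
Proof.
move=> tab.
have k0 : 0 <= 2^-1 :> R by rewrite invr_ge0.
have k1 : 2^-1 <= 1 :> R by rewrite invf_le1// ler1n.
have := h5 tab (Itv01 k0 k1) (x := (x1, y1)) (y := (x2, y2)).
have kE : unstable.onem (2^-1 : R) = 2^-1 by rewrite /unstable.onem; field.
rewrite !inE => /(_ I I).
have cE (p q : R^o) : conv (Itv01 k0 k1) p q = 2^-1 * p + unstable.onem 2^-1 * q by [].
by rewrite [leRHS]cE /conv/= kE.
Qed.

Lemma graph_mid u1 v1 u2 v2 : graph u1 v1 -> graph u2 v2 ->
  graph (mid u1 u2) (mid v1 v2).
Proof. exact: graph_lin. Qed.

(** The integrated midpoint convexity gap. Its sign gives convexity of the functional; its vanishing
    forces uniqueness under strict convexity. *)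
Let gapE u1 v1 u2 v2 : graph u1 v1 -> graph u2 v2 ->
  \int[mu]_(t in `[a, b]) (2^-1 * L (u1 t) (v1 t) t + 2^-1 * L (u2 t) (v2 t) t -
     L (mid u1 u2 t) (mid v1 v2 t) t) =
  2^-1 * Jp u1 v1 + 2^-1 * Jp u2 v2 - Jp (mid u1 u2) (mid v1 v2) /\
  mu.-integrable `[a, b] (EFin \o (fun t =>
     2^-1 * L (u1 t) (v1 t) t + 2^-1 * L (u2 t) (v2 t) t -
     L (mid u1 u2 t) (mid v1 v2 t) t)).
Proof.
move=> g1 g2; have gm := graph_mid g1 g2.
have i1 := ig g1; have i2 := ig g2; have im := ig gm.
have iZ (f : R -> R) : mu.-integrable `[a, b] (EFin \o f) ->
    mu.-integrable `[a, b] (EFin \o (fun t => 2^-1 * f t)).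
  move=> i; have := integrableZl mD 2^-1 i.
  by apply: eq_integrable => // t _; rewrite /= EFinM.
have iD : mu.-integrable `[a, b] (EFin \o (fun t =>
    2^-1 * L (u1 t) (v1 t) t + 2^-1 * L (u2 t) (v2 t) t)).
  have := integrableD mD (iZ _ i1) (iZ _ i2).
  by apply: eq_integrable => // t _; rewrite /= EFinD.
split.
  by rewrite RintegralB// RintegralD ?RintegralZl//; exact: iZ.
have := integrableB mD iD im.
by apply: eq_integrable => // t _; rewrite /= EFinB.
Qed.

Lemma pair_action_mid u1 v1 u2 v2 : graph u1 v1 -> graph u2 v2 ->
  Jp (mid u1 u2) (mid v1 v2) <= 2^-1 * Jp u1 v1 + 2^-1 * Jp u2 v2.
Proof.
move=> g1 g2; have [gE _] := gapE g1 g2.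
rewrite -subr_ge0 -gE; apply: Rintegral_ge0 => t tab.
by rewrite subr_ge0 midpoint_convex.
Qed.

(* [low n] is the sublevel set at height [m + 1 / (n + 1)], [q n] the infimum over
   it of the squared norm; [q] is nondecreasing and bounded by coercivity, so the
   parallelogram identity makes nearly norm-minimal elements Cauchy. *)
Lemma exists_pair_minimizer : exists u v, graph u v /\
  forall u' v', graph u' v' -> Jp u v <= Jp u' v'.
Proof.
have [k k0 [K hK]] := coercive sigma ab al hL hd1 hr1 hs1 h1 hzeta hd4 hc1zeta hc2 hc3 h4.
have g0 := graph0 sigma ab al.
pose S : set R := [set x | exists u v, graph u v /\ x = Jp u v].
have lbS : lbound S (- K).
  move=> x [u [v [g ->]]]; apply: le_trans (hK u v g).
  by rewrite -[leLHS]add0r lerD2r mulr_ge0 ?sqnorm_ge0 ?(ltW k0).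
have infS : has_inf S by split; [exists (Jp (fun=> 0) (fun=> 0)); exists (fun=> 0), (fun=> 0)|exists (- K)].
pose m := inf S.
have mle u v : graph u v -> m <= Jp u v.
  by move=> g; apply: ge_inf; [exists (- K)|exists u, v].
pose h (n : nat) : R := n.+1%:R^-1.
have h0 n : 0 < h n by rewrite invr_gt0 ltr0n.
have hle i j : (i <= j)%N -> h j <= h i.
  by move=> ij; rewrite lef_pV2 ?posrE ?ltr0n// ler_nat.
pose low n u v := graph u v /\ Jp u v <= m + h n.
have exlow n : exists u v, low n u v.
  have [x [u [v [g ->]]] xm] := inf_adherent (h0 n) infS.
  by exists u, v; split => //; exact: ltW.
pose Q := (m + 1 + K) / k.
have lowQ n u v : low n u v -> nrm v <= Q.
  move=> [g Jm]; rewrite ler_pdivlMr// mulrC.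
  have := hK u v g; have : h n <= 1 by rewrite -[1]invr1; exact: (hle 0%N).
  by move: Jm; lra.
pose T n : set R := [set x | exists u v, low n u v /\ x = nrm v].
have lbT n : lbound (T n) 0 by move=> x [u [v [_ ->]]]; exact: sqnorm_ge0.
have infT n : has_inf (T n).
  by split; [have [u [v l]] := exlow n; exists (nrm v), u, v|exists 0].
pose q n := inf (T n).
have qle n u v : low n u v -> q n <= nrm v.
  by move=> l; apply: ge_inf; [exists 0; exact: lbT|exists u, v].
have lowS i j u v : (i <= j)%N -> low j u v -> low i u v.
  move=> ij [g J]; split => //; apply: le_trans J _.
  by rewrite lerD2l hle.
have qmono i j : (i <= j)%N -> q i <= q j.
  move=> ij; apply: lb_le_inf; first by case: (infT j).
  by move=> x [u [v [l ->]]]; apply: qle; exact: lowS l.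
have /choice[w hw] : forall n, exists w : (R -> R) * (R -> R),
    low n w.1 w.2 /\ nrm w.2 < q n + h n.
  move=> n; have [x [u [v [l ->]]] xq] := inf_adherent (h0 n) (infT n).
  by exists (u, v).
pose u_ n := (w n).1; pose v_ n := (w n).2.
have lw n : low n (u_ n) (v_ n) by case: (hw n).
have gw n : graph (u_ n) (v_ n) by case: (lw n).
have sv n : sqi (v_ n) by case: (gw n).
have qQ n : q n <= Q by apply: le_trans (lowQ _ _ _ (lw n)); exact: qle.
have cv : sqcauchy a b v_.
  move=> e e0.
  have hs : has_sup (range q) by split; [exists (q 0%N), 0%N|exists Q => _ [n _ <-]].
  (* In [2 |v_i|^2 + 2 |v_j|^2 - 4 |mid|^2] the slack [h N2] and the gap between [q N1] and the
     supremum each enter four times, giving [e] in total. *)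
  have e80 : 0 < e / 8 by rewrite divr_gt0.
  have [_ [N1 _ <-] hN1] := sup_adherent e80 hs.
  have [N2 hN2] := ltr_add_invr e80; rewrite add0r -/(h N2) in hN2.
  pose N := maxn N1 N2; exists N => i j Ni Nj.
  rewrite sqnormB//.
  (* Convexity keeps the midpoint in the same sublevel set, so its squared norm is at least
     [q N]. *)
  have lm : low N (mid (u_ i) (u_ j)) (mid (v_ i) (v_ j)).
    split; first exact: graph_mid.
    apply: (le_trans (pair_action_mid (gw i) (gw j))).
    have [_ Ji] := lowS _ _ _ _ Ni (lw i); have [_ Jj] := lowS _ _ _ _ Nj (lw j).
    by move: Ji Jj; lra.
  have qm := qle _ _ _ lm.
  have [_ vi] := hw i; have [_ vj] := hw j.
  have supq n : q n <= sup (range q) by apply: ub_le_sup; [exists Q => _ [? _ <-]|exists n].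
  have qi := supq i; have qj := supq j.
  have qN : q N1 <= q N by apply: qmono; exact: leq_maxl.
  have hi : h i <= h N2 by apply: hle; rewrite (leq_trans _ Ni)// leq_maxr.
  have hj : h j <= h N2 by apply: hle; rewrite (leq_trans _ Nj)// leq_maxr.
  rewrite -/(v_ i) -/(v_ j) in vi vj.
  move: qm vi vj qi qj qN hi hj hN1 hN2.
  move: (nrm (v_ i)) (nrm (v_ j)) (nrm _) (q i) (q j) (q N) (q N1) (sup _) (h i) (h j) (h N2).
  by move=> *; lra.
have [u [v [s [g uu hs vv]]]] := graph_closed ab al gw cv.
exists u, v; split => // u' v' g'; apply: le_trans (mle _ _ g').
apply: (pair_action_lsc ab al hL hd1 hr1 hs1 h1 hzeta hd4 hc1zeta hc2 hc3 h4
  (u_ := fun n => u_ (s n)) (v_ := fun n => v_ (s n)) (Q := Q) _ _ g _ vv).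
- by move=> n; exact: gw.
- by move=> n; exact: lowQ (lw (s n)).
- move=> t tab; apply/cvgrPdist_le => e e0; have [N hN] := uu e e0.
  exists N => // n /= Nn; rewrite distrC; apply: hN => //.
  exact: leq_trans (hs n).
- move=> e e0; have [N] := ltr_add_invr e0; rewrite add0r -/(h N) => hN.
  exists N => n Nn; have [_ J] := lw (s n).
  apply: (le_trans J); rewrite lerD2l; apply: le_trans (ltW hN).
  by apply: hle; exact: leq_trans (hs n).
Qed.

Let actionE u v : graph u v -> action a b alpha sigma L u = Jp u v.
Proof. exact: (action_graph ab al hL). Qed.

Lemma exists_minimizer : exists u, minimizer a b alpha sigma L u.
Proof.
have [u [v [g hmin]]] := exists_pair_minimizer; exists u; split.
  exact: Hspace_of_graph g.
move=> u' Hu'; have g' := graph_caputoH ab al Hu'.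
by rewrite (actionE g) (actionE g') hmin.
Qed.

Lemma minimizer_unique :
  (forall t, t \in `[a, b] ->
      @strictly_convex_function R (R^o * R^o)%type
        (fun p : R^o * R^o => L p.1 p.2 t)) ->
  forall u1 u2, minimizer a b alpha sigma L u1 -> minimizer a b alpha sigma L u2 ->
     {in `[a, b], u1 =1 u2}.
Proof.
move=> sc u1 u2 [H1 min1] [H2 min2].
have g1 := graph_caputoH ab al H1; have g2 := graph_caputoH ab al H2.
set v1 := caputoH _ _ _ _ u1 in g1; set v2 := caputoH _ _ _ _ u2 in g2.
have gm := graph_mid g1 g2.
have m12 := min1 _ H2; have m21 := min2 _ H1.
have mm := min1 _ (Hspace_of_graph ab al gm).
rewrite !(actionE g1) !(actionE g2) (actionE gm) in m12 m21 mm.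
have [gE iG] := gapE g1 g2.
set G := (fun t => _ - _) in gE iG.
have G0 t : t \in `[a, b] -> 0 <= G t.
  by move=> tab; rewrite subr_ge0 midpoint_convex.
(* The two minimizers have equal action and their midpoint cannot go below it, so the gap has
   nonpositive integral. *)
have intG : \int[mu]_(t in `[a, b]) G t = 0.
  apply/eqP; rewrite eq_le; apply/andP; split; last exact: Rintegral_ge0.
  rewrite gE; move: m12 m21 mm.
  by move: (Jp _ _) (Jp _ _) (Jp _ _) => *; lra.
have mG : measurable_fun `[a, b] (EFin \o G) by case/integrableP: iG.
have aeG : {ae mu, forall t, t \in `[a, b] -> G t = 0}.
  have [+ _] := ae_eq_integral_abs mu mD mG.
  have -> : (\int[mu]_(t in `[a, b]) `|(EFin \o G) t| = 0)%E.
    rewrite (eq_integral (EFin \o G)); last first.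
      by move=> t; rewrite inE => tab /=; rewrite ger0_norm ?G0.
    by rewrite -[LHS]fineK ?integrable_fin_num//; congr EFin.
  by move=> /(_ erefl); apply: ae_imply => t + tab => /(_ tab)/= [].
have [c1' _ _] := g1; have [c2' _ _] := g2.
apply: (continuous_ae_eq ab c1' c2').
apply: ae_imply aeG => t /[swap] tab /(_ tab) Gt0.
(* If [u1 t] and [u2 t] differ, the pairs with the derivatives differ too, whatever [v1 t] and
   [v2 t] are, and strict convexity makes the gap positive. *)
apply: contrapT => u12.
have k0 : 0 < 2^-1 :> R by rewrite invr_gt0.
have k1 : 2^-1 < 1 :> R by rewrite invf_lt1// ltr1n.
have pq : (u1 t, v1 t) <> (u2 t, v2 t) by case.
have := sc t tab 2^-1 (u1 t, v1 t) (u2 t, v2 t) k0 k1 pq.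
have -> : 1 - 2^-1 = 2^-1 :> R by field.
move=> h; have : 0 < G t by rewrite subr_gt0; exact: h.
by rewrite Gt0 ltxx.
Qed.

End direct_method.

Theorem theorem4p1 (R : realType) (a b alpha sigma : R)
    (L : R -> R -> R -> R)
    (d1 d2 d3 d4 zeta : R) (r1 s1 r2 s2 r3 s3 c1 : R -> R -> R)
    (c2 c3 : R -> R)
    (hab : a < b) (halpha : 2^-1 < alpha < 1) (hsigma : 0 < sigma)
    (hL : C1_strip a b L)
    (hd1 : 0 < d1 <= 2)
    (hr1 : continuous_strip2 a b r1) (hs1 : continuous_strip2 a b s1)
    (hr1s1 : forall x t, t \in `[a, b] -> 0 <= r1 x t /\ 0 <= s1 x t)
    (h1 : forall x y t, t \in `[a, b] ->
      `|L x y t - L x 0 t| <= r1 x t * `|y| `^ d1 + s1 x t)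
    (hd2 : 0 < d2 <= 2)
    (hr2 : continuous_strip2 a b r2) (hs2 : continuous_strip2 a b s2)
    (hr2s2 : forall x t, t \in `[a, b] -> 0 <= r2 x t /\ 0 <= s2 x t)
    (h2 : forall x y t, t \in `[a, b] ->
      `|partial_x L x y t| <= r2 x t * `|y| `^ d2 + s2 x t)
    (hd3 : 0 < d3 <= 1)
    (hr3 : continuous_strip2 a b r3) (hs3 : continuous_strip2 a b s3)
    (hr3s3 : forall x t, t \in `[a, b] -> 0 <= r3 x t /\ 0 <= s3 x t)
    (h3 : forall x y t, t \in `[a, b] ->
      `|partial_y L x y t| <= r3 x t * `|y| `^ d3 + s3 x t)
    (hzeta : 0 < zeta) (hd4 : 1 <= d4 < 2)
    (hc1 : continuous_strip2 a b c1)
    (hc1zeta : forall x t, t \in `[a, b] -> zeta <= c1 x t)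
    (hc2 : {within `[a, b], continuous c2})
    (hc3 : {within `[a, b], continuous c3})
    (h4 : forall x y t, t \in `[a, b] ->
      c1 x t * `|y| ^+ 2 + c2 t * `|x| `^ d4 + c3 t <= L x y t)
    (h5 : forall t, t \in `[a, b] ->
      @convex_function R (R^o * R^o)%type setT
        (fun p : R^o * R^o => L p.1 p.2 t)) :
  (exists u0 : R -> R, minimizer a b alpha sigma L u0) /\
  ((forall t, t \in `[a, b] ->
      @strictly_convex_function R (R^o * R^o)%type
        (fun p : R^o * R^o => L p.1 p.2 t)) ->
   forall u1 u2 : R -> R,
     minimizer a b alpha sigma L u1 -> minimizer a b alpha sigma L u2 ->
     {in `[a, b], u1 =1 u2}).
Proof.
split.
  exact: (exists_minimizer sigma hab halpha hL hd1 hr1 hs1 h1 hzeta hd4 hc1zeta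
    hc2 hc3 h4 h5).
exact: (minimizer_unique hab halpha hL hd1 hr1 hs1 h1 h5).
Qed.
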